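(* For the Dedukti encoding $(\Sigma_{EPTS},\mathscr R_{EPTS})$ of a functional PTS specification: (1) $\hookrightarrow_\beta\cup\hookrightarrow_{\mathscr R_{EPTS}}$ is confluent; (2) for every $c[\Delta]:A\in\Sigma_{EPTS}$ one has $\Delta\vdash_{DK}A:s$ for some $s\in\{\mathtt{TYPE},\mathtt{KIND}\}$; (3) if $\Gamma\vdash_{DK}M:A$ and $M\hookrightarrow_\beta M'$ then $\Gamma\vdash_{DK}M':A$; (4) if $\Gamma\vdash_{DK}M:A$ then $\beta$ is strongly normalizing on $M$; (5) for all EPTS terms $M,N$, $[\![M]\!]\{[\![N]\!]/x\}=[\![M\{N/x\}]\!]$.
   Context: Functional PTS specification $(\mathcal S,\mathcal A,\mathcal R)$: $\mathcal A\subseteq\mathcal S^2$ functional, $\mathcal R\subseteq\mathcal S^3$ functional in its first two components. EPTS terms $x\mid s\mid\Pi_{s_1,s_2}(A,x.B)\mid\lambda_{s_1,s_2}(A,x.B,x.M)\mid@_{s_1,s_2}(A,x.B,M,N)$. Dedukti: $\lambda\Pi$-calculus with constants $c[\Delta]:A$ of fixed arity (written $c\,\vec M$), conversion modulo $\beta$ and rewrite rules; $\Gamma\vdash_{DK}M:A$ denotes Dedukti typing in the theory $(\Sigma_{EPTS},\mathscr R_{EPTS})$ given by: $\mathbf U_s:\mathtt{TYPE}$, $\mathbf{El}_s[A:\mathbf U_s]:\mathtt{TYPE}$ ($s\in\mathcal S$); for $(s_1,s_2)\in\mathcal A$: $\mathbf u_{s_1}:\mathbf U_{s_2}$ and rule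 $\mathbf{El}_{s_2}\mathbf u_{s_1}\hookrightarrow\mathbf U_{s_1}$; for $(s_1,s_2,s_3)\in\mathcal R$: $\mathbf{Prod}_{s_1,s_2}[A:\mathbf U_{s_1};B:\mathbf{El}_{s_1}A\to\mathbf U_{s_2}]:\mathbf U_{s_3}$, $\mathbf{abs}_{s_1,s_2}[A:\mathbf U_{s_1};B:\mathbf{El}_{s_1}A\to\mathbf U_{s_2};M:\Pi x:\mathbf{El}_{s_1}A.\mathbf{El}_{s_2}(Bx)]:\mathbf{El}_{s_3}(\mathbf{Prod}_{s_1,s_2}AB)$, $\mathbf{app}_{s_1,s_2}[A:\mathbf U_{s_1};B:\mathbf{El}_{s_1}A\to\mathbf U_{s_2};M:\mathbf{El}_{s_3}(\mathbf{Prod}_{s_1,s_2}AB);N:\mathbf{El}_{s_1}A]:\mathbf{El}_{s_2}(BN)$, and rule $\mathbf{app}_{s_1,s_2}AB(\mathbf{abs}_{s_1,s_2}A'B'M)N\hookrightarrow MN$. Translation: $[\![x]\!]=x$, $[\![s]\!]=\mathbf u_s$, $[\![\Pi_{s_1,s_2}(A,x.B)]\!]=\mathbf{Prod}_{s_1,s_2}[\![A]\!](\lambda x:\mathbf{El}_{s_1}[\![A]\!].[\![B]\!])$, $[\![\lambda_{s_1,s_2}(A,x.B,x.M)]\!]=\mathbf{abs}_{s_1,s_2}[\![A]\!](\lambda x:\mathbf{El}_{s_1}[\![A]\!].[\![B]\!])(\lambda x:\mathbf{El}_{s_1}[\![A]\!].[\![M]\!])$, $[\![@_{s_1,s_2}(A,x.B,M,N)]\!]=\mathbf{app}_{s_1,s_2}[\![A]\!](\lambda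 x:\mathbf{El}_{s_1}[\![A]\!].[\![B]\!])[\![M]\!][\![N]\!]$. *)

(* Defs.v *)
From Stdlib Require Import List Arith Relations.
From Stdlib Require Vector.
Import ListNotations Vector.VectorNotations.
Local Open Scope list_scope.

Set Implicit Arguments.
Unset Strict Implicit.

(** * Dedukti: the lambda-Pi-calculus with constants of fixed arity, modulo
    beta and rewrite rules *)

Record arities : Type := Arities { cname : Type; ar : cname -> nat }.

Inductive srt : Set := TYPE | KIND.

(* De Bruijn syntax: [Pi A B] and [Lam A M] bind index 0 in [B], resp. [M]. *)
Inductive term (K : arities) : Type :=
| Var (x : nat)
| Cst (c : cname K) (v : Vector.t (term K) (ar c))
| Srt (s : srt)
| Pi (A B : term K)
| Lam (A M : term K)
| App (M N : term K).

Arguments Var {K} x.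
Arguments Cst {K} c v.
Arguments Srt {K} s.

Section Substitution.
Variable K : arities.
Implicit Types (M N A B : term K).

Definition upren (r : nat -> nat) (x : nat) : nat :=
  match x with 0 => 0 | S y => S (r y) end.

Fixpoint ren (r : nat -> nat) (M : term K) : term K :=
  match M with
  | Var x => Var (r x)
  | Cst c v => Cst c (Vector.map (ren r) v)
  | Srt s => Srt s
  | Pi A B => Pi (ren r A) (ren (upren r) B)
  | Lam A N => Lam (ren r A) (ren (upren r) N)
  | App N P => App (ren r N) (ren r P)
  end.

Definition up (f : nat -> term K) (x : nat) : term K :=
  match x with 0 => Var 0 | S y => ren S (f y) end.

Fixpoint subst (f : nat -> term K) (M : term K) : term K :=
  match M with
  | Var x => f x
  | Cst c v => Cst c (Vector.map (subst f) v)
  | Srt s => Srt s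
  | Pi A B => Pi (subst f A) (subst (up f) B)
  | Lam A N => Lam (subst f A) (subst (up f) N)
  | App N P => App (subst f N) (subst f P)
  end.

(* Index 0 is sent to the head of [Ms], index 1 to the next element, etc.;
   the indices beyond [Ms] are lowered by [length Ms]. *)
Definition inst (Ms : list (term K)) (x : nat) : term K :=
  List.nth x Ms (Var (x - length Ms)).

(* M{N/x} for [x] the variable bound by the innermost enclosing binder, which
   is removed. *)
Definition subst0 (N M : term K) : term K := subst (inst [N]) M.

(* M{N/x} for a free variable [x]: all other variables are unchanged. *)
Definition subst_var (x : nat) (N M : term K) : term K :=
  subst (fun y => if y =? x then N else Var y) M.

(** Closure under contexts of a relation on terms. *)
Inductive ctx_closure (R : relation (term K)) : relation (term K) :=
| cc_head M N : R M N -> ctx_closure R M N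
| cc_Cst c (v : Vector.t (term K) (ar c)) (i : Fin.t (ar c)) N :
    ctx_closure R (Vector.nth v i) N ->
    ctx_closure R (Cst c v) (Cst c (Vector.replace v i N))
| cc_Pi_l A A' B : ctx_closure R A A' -> ctx_closure R (Pi A B) (Pi A' B)
| cc_Pi_r A B B' : ctx_closure R B B' -> ctx_closure R (Pi A B) (Pi A B')
| cc_Lam_l A A' M : ctx_closure R A A' -> ctx_closure R (Lam A M) (Lam A' M)
| cc_Lam_r A M M' : ctx_closure R M M' -> ctx_closure R (Lam A M) (Lam A M')
| cc_App_l M M' N : ctx_closure R M M' -> ctx_closure R (App M N) (App M' N)
| cc_App_r M N N' : ctx_closure R N N' -> ctx_closure R (App M N) (App M N').

Inductive beta_head : relation (term K) :=
| beta_intro A M N : beta_head (App (Lam A M) N) (subst0 N M).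

Definition beta : relation (term K) := ctx_closure beta_head.

End Substitution.

(* Contexts list the most recent declaration first; each type lives in the
   context formed by the rest of the list. *)
Definition ctx (K : arities) : Type := list (term K).

(* [decl c D A] is the declaration c[D] : A, where [A] lives in [D], and
   [rule l r] is the rewrite rule l --> r, whose pattern variables are the free
   variables of [l]. *)
Record theory (K : arities) : Type := Theory {
  decl : cname K -> ctx K -> term K -> Prop;
  rule : term K -> term K -> Prop
}.

Section Dedukti.
Variables (K : arities) (T : theory K).

Inductive rew_head : relation (term K) :=
| rew_intro l r (f : nat -> term K) :
    rule T l r -> rew_head (subst f l) (subst f r).

Definition rew : relation (term K) := ctx_closure rew_head.

Definition beta_rew : relation (term K) := union (term K) (@beta K) rew.

Definition conv : relation (term K) := clos_refl_sym_trans (term K) beta_rew.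

Inductive wf : ctx K -> Prop :=
| wf_nil : wf []
| wf_cons G A : wf G -> typing G A (Srt TYPE) -> wf (A :: G)

with typing : ctx K -> term K -> term K -> Prop :=
| t_sort G : wf G -> typing G (Srt TYPE) (Srt KIND)
| t_var G x A :
    wf G -> nth_error G x = Some A ->
    typing G (Var x) (ren (fun y => S x + y) A)
| t_cst G c (v : Vector.t (term K) (ar c)) D A :
    decl T c D A ->
    typing_args G (rev (Vector.to_list v)) D ->
    typing G (Cst c v) (subst (inst (rev (Vector.to_list v))) A)
| t_pi G A B s :
    typing G A (Srt TYPE) -> typing (A :: G) B (Srt s) ->
    typing G (Pi A B) (Srt s)
| t_lam G A B M s :
    typing G A (Srt TYPE) -> typing (A :: G) B (Srt s) ->
    typing (A :: G) M B ->
    typing G (Lam A M) (Pi A B)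
| t_app G A B M N :
    typing G M (Pi A B) -> typing G N A ->
    typing G (App M N) (subst0 N B)
| t_conv G M A B s :
    typing G M A -> typing G B (Srt s) -> conv A B ->
    typing G M B

(* The arguments are listed, like contexts, with the last one first. *)
with typing_args : ctx K -> list (term K) -> ctx K -> Prop :=
| ta_nil G : wf G -> typing_args G [] []
| ta_cons G Ms D M A :
    typing_args G Ms D -> typing G M (subst (inst Ms) A) ->
    typing_args G (M :: Ms) (A :: D).

End Dedukti.

Definition confluent (X : Type) (R : relation X) : Prop :=
  forall M N P,
    clos_refl_trans X R M N -> clos_refl_trans X R M P ->
    exists Q, clos_refl_trans X R N Q /\ clos_refl_trans X R P Q.

Definition strongly_normalizing (X : Type) (R : relation X) (M : X) : Prop :=
  Acc (fun y x => R x y) M.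

(** * Explicitly-typed pure type systems *)

Record pts_spec : Type := PtsSpec {
  sort : Type;
  pts_ax : sort -> sort -> Prop;
  pts_rule : sort -> sort -> sort -> Prop
}.

Definition functional_spec (P : pts_spec) : Prop :=
  (forall s1 s2 s2' : sort P, pts_ax s1 s2 -> pts_ax s1 s2' -> s2 = s2') /\
  (forall s1 s2 s3 s3' : sort P,
      pts_rule s1 s2 s3 -> pts_rule s1 s2 s3' -> s3 = s3').

(* De Bruijn syntax: index 0 is bound in [B] (in all three constructors) and in
   the [M] of [ELam], but not in the [M] and [N] of [EApp]. *)
Inductive eterm (P : pts_spec) : Type :=
| EVar (x : nat)
| ESort (s : sort P)
| EPi (s1 s2 : sort P) (A B : eterm P)
| ELam (s1 s2 : sort P) (A B M : eterm P)
| EApp (s1 s2 : sort P) (A B M N : eterm P).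

Arguments EVar {P} x.
Arguments ESort {P} s.

Section ESubstitution.
Variable P : pts_spec.

Fixpoint eren (r : nat -> nat) (M : eterm P) : eterm P :=
  match M with
  | EVar x => EVar (r x)
  | ESort s => ESort s
  | EPi s1 s2 A B => EPi s1 s2 (eren r A) (eren (upren r) B)
  | ELam s1 s2 A B N =>
      ELam s1 s2 (eren r A) (eren (upren r) B) (eren (upren r) N)
  | EApp s1 s2 A B N Q =>
      EApp s1 s2 (eren r A) (eren (upren r) B) (eren r N) (eren r Q)
  end.

Definition eup (f : nat -> eterm P) (x : nat) : eterm P :=
  match x with 0 => EVar 0 | S y => eren S (f y) end.

Fixpoint esubst (f : nat -> eterm P) (M : eterm P) : eterm P :=
  match M with
  | EVar x => f x
  | ESort s => ESort s
  | EPi s1 s2 A B => EPi s1 s2 (esubst f A) (esubst (eup f) B)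
  | ELam s1 s2 A B N =>
      ELam s1 s2 (esubst f A) (esubst (eup f) B) (esubst (eup f) N)
  | EApp s1 s2 A B N Q =>
      EApp s1 s2 (esubst f A) (esubst (eup f) B) (esubst f N) (esubst f Q)
  end.

Definition esubst0 (N M : eterm P) : eterm P :=
  esubst (fun y => match y with 0 => N | S z => EVar z end) M.

Definition esubst_var (x : nat) (N M : eterm P) : eterm P :=
  esubst (fun y => if y =? x then N else EVar y) M.

End ESubstitution.

(** * The encoding of EPTSs in Dedukti *)

Section Encoding.
Variable P : pts_spec.
Implicit Types s : sort P.

Inductive epts_cst : Type :=
| cU s | cEl s | cu s | cProd s1 s2 | cabs s1 s2 | capp s1 s2.

Definition epts_ar (c : epts_cst) : nat :=
  match c with
  | cU _ => 0 | cEl _ => 1 | cu _ => 0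
  | cProd _ _ => 2 | cabs _ _ => 3 | capp _ _ => 4
  end.

Definition epts_arities : arities := Arities epts_ar.

Notation tm := (term epts_arities).

Definition dU s : tm := @Cst epts_arities (cU s) []%vector.
Definition dEl s (A : tm) : tm := @Cst epts_arities (cEl s) [A]%vector.
Definition du s : tm := @Cst epts_arities (cu s) []%vector.
Definition dProd s1 s2 (A B : tm) : tm :=
  @Cst epts_arities (cProd s1 s2) [A; B]%vector.
Definition dabs s1 s2 (A B M : tm) : tm :=
  @Cst epts_arities (cabs s1 s2) [A; B; M]%vector.
Definition dapp s1 s2 (A B M N : tm) : tm :=
  @Cst epts_arities (capp s1 s2) [A; B; M; N]%vector.

(* A : U_s1; B : El_s1 A -> U_s2 *)
Definition ctx_AB s1 s2 : ctx epts_arities :=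
  [Pi (dEl s1 (Var 0)) (dU s2); dU s1].

(* Constants [cu s], [cProd s1 s2], ... whose sorts are not related by the
   specification are names that are not declared in the signature. *)
Inductive epts_decl : epts_cst -> ctx epts_arities -> tm -> Prop :=
| decl_U s : epts_decl (cU s) [] (Srt TYPE)
| decl_El s : epts_decl (cEl s) [dU s] (Srt TYPE)
| decl_u s1 s2 : pts_ax s1 s2 -> epts_decl (cu s1) [] (dU s2)
| decl_Prod s1 s2 s3 :
    pts_rule s1 s2 s3 -> epts_decl (cProd s1 s2) (ctx_AB s1 s2) (dU s3)
| decl_abs s1 s2 s3 :
    pts_rule s1 s2 s3 ->
    epts_decl (cabs s1 s2)
      (* M : Pi x : El_s1 A. El_s2 (B x) *)
      (Pi (dEl s1 (Var 1)) (dEl s2 (App (Var 1) (Var 0))) :: ctx_AB s1 s2)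
      (dEl s3 (dProd s1 s2 (Var 2) (Var 1)))
| decl_app s1 s2 s3 :
    pts_rule s1 s2 s3 ->
    epts_decl (capp s1 s2)
      (* M : El_s3 (Prod A B); N : El_s1 A *)
      (dEl s1 (Var 2) :: dEl s3 (dProd s1 s2 (Var 1) (Var 0)) :: ctx_AB s1 s2)
      (dEl s2 (App (Var 2) (Var 0))).

Inductive epts_rule : tm -> tm -> Prop :=
| rule_El s1 s2 : pts_ax s1 s2 -> epts_rule (dEl s2 (du s1)) (dU s1)
(* A = 5, B = 4, A' = 3, B' = 2, M = 1, N = 0 *)
| rule_app s1 s2 s3 :
    pts_rule s1 s2 s3 ->
    epts_rule
      (dapp s1 s2 (Var 5) (Var 4) (dabs s1 s2 (Var 3) (Var 2) (Var 1)) (Var 0))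
      (App (Var 1) (Var 0)).

Definition epts_theory : theory epts_arities :=
  @Theory epts_arities epts_decl epts_rule.

Fixpoint tr (M : eterm P) : tm :=
  match M with
  | EVar x => Var x
  | ESort s => du s
  | EPi s1 s2 A B => dProd s1 s2 (tr A) (Lam (dEl s1 (tr A)) (tr B))
  | ELam s1 s2 A B N =>
      dabs s1 s2 (tr A) (Lam (dEl s1 (tr A)) (tr B)) (Lam (dEl s1 (tr A)) (tr N))
  | EApp s1 s2 A B N Q =>
      dapp s1 s2 (tr A) (Lam (dEl s1 (tr A)) (tr B)) (tr N) (tr Q)
  end.

End Encoding.

(* Main.v *)
(** Confluence: beta and the two rewrite rules are left-linear without critical
    pairs, so a parallel reduction has the diamond property.  Hence conversion
    is injective on products, and subject reduction for beta follows from the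
    substitution lemma as usual.

    Strong normalization: types have no variables at their head and the rewrite
    rules never produce a product, so erasing dependencies sends types to simple
    types in a way that is invariant under conversion.  A reducibility argument
    indexed by these simple types, on the raw terms themselves (domain
    annotations of abstractions included), then shows that well-typed terms are
    reducible. *)

Require Import Defs.
From Stdlib Require Import List Relations Lia Arith.
From Stdlib Require Vector.
Import ListNotations.

Set Implicit Arguments.
Unset Strict Implicit.

(** * Vectors and closures of relations *)

(** Conversion ranges over untyped terms, and both subject reduction and normalization depend on it,
    so confluence has to be available on raw terms before any typing. This is possible because the
    [app] rule names [A], [B] and [A'], [B'] apart: matching compares no two subterms. Normalization
    holds for every specification, including those whose pure type system does not normalize,
    because the encoding keeps [El (Prod A B)] apart from the framework's own product. Instances of
    [U_s] and [El_s A] all erase to the base type, so for beta alone [abs] and [app] are inert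
    constants, reducible as soon as their arguments are strongly normalizing. The impredicativity of
    the object system never reaches the reducibility argument; the rewrite rules enter it only
    through the conversion rule. *)

Section Vectors.
Variables X Y : Type.

Lemma vector_map_eq (f g : X -> Y) n (v : Vector.t X n) :
  (forall i, f (Vector.nth v i) = g (Vector.nth v i)) ->
  Vector.map f v = Vector.map g v.
Proof.
  intros H; apply Vector.eq_nth_iff; intros i _ <-.
  rewrite !(Vector.nth_map _ _ _ _ eq_refl); apply H.
Qed.

Lemma vector_map_replace (f : X -> Y) n (v : Vector.t X n) i a :
  Vector.map f (Vector.replace v i a) =
  Vector.replace (Vector.map f v) i (f a).
Proof.
  induction v as [|b n v IH].
  - pattern i; apply Fin.case0.
  - pattern i; apply Fin.caseS'; simpl; [reflexivity|].
    intros j; f_equal; apply IH.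
Qed.

(** Finite choice, used to assemble the common reducts of the arguments of a constant into one
    vector. *)
Lemma vector_choice n (R : Fin.t n -> X -> Prop) :
  (forall i, exists a, R i a) ->
  exists w : Vector.t X n, forall i, R i (Vector.nth w i).
Proof.
  induction n as [|n IH]; intros H.
  - exists (Vector.nil X); intros i; pattern i; apply Fin.case0.
  - destruct (H Fin.F1) as [a Ha].
    destruct (IH (fun i => R (Fin.FS i))) as [w Hw]; [intros i; apply H|].
    exists (Vector.cons X a n w); intros i; pattern i.
    apply Fin.caseS'; [exact Ha | exact Hw].
Qed.

(** The entries are changed one at a time, head first. [E] is generalized so that the induction can
    use [E] with the new head held fixed. *)
Lemma vector_pointwise_chain (R : relation X) n (E : relation (Vector.t X n)) :
  (forall v, E v v) -> (forall u v w, E u v -> E v w -> E u w) ->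
  (forall v i a, R (Vector.nth v i) a -> E v (Vector.replace v i a)) ->
  forall v w, (forall i, R (Vector.nth v i) (Vector.nth w i)) -> E v w.
Proof.
  revert E; induction n as [|n IH]; intros E Hr Ht Hs v w.
  - pattern v; apply Vector.case0; pattern w; apply Vector.case0; auto.
  - pattern v; apply Vector.caseS'; clear v; intros a v.
    pattern w; apply Vector.caseS'; clear w; intros b w H.
    apply Ht with (Vector.cons X b n v).
    + apply (Hs (Vector.cons X a n v) Fin.F1 b), (H Fin.F1).
    + apply (IH (fun x y => E (Vector.cons X b n x) (Vector.cons X b n y))).
      * auto.
      * intros x y z; apply Ht.
      * intros x i c Hc; apply (Hs (Vector.cons X b n x) (Fin.FS i) c Hc).
      * intros i; apply (H (Fin.FS i)).
Qed.

Definition vector_step (R : relation X) n : relation (Vector.t X n) :=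
  fun v w => exists i a, R (Vector.nth v i) a /\ w = Vector.replace v i a.

Lemma vector_strongly_normalizing (R : relation X) n (v : Vector.t X n) :
  (forall i, strongly_normalizing R (Vector.nth v i)) ->
  strongly_normalizing (vector_step R (n:=n)) v.
Proof.
  induction v as [|a n v IH]; intros H.
  - constructor; intros w (i & _); pattern i; apply Fin.case0.
  - specialize (IH (fun i => H (Fin.FS i))); specialize (H Fin.F1).
    (* Nested accessibility induction, outer on the head and inner on the tail: a head step may
       restart with any normalizing tail. *)
    simpl in H; clear - H IH; revert v IH.
    induction H as [a _ IHa]; intros v Hv.
    induction Hv as [v Hv IHv]; constructor.
    intros w (i & b & Hb & ->); revert Hb.
    pattern i; apply Fin.caseS'; simpl.
    + intros Hb; apply IHa; [exact Hb | constructor; exact Hv].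
    + intros j Hb; apply IHv; exists j, b; auto.
Qed.

Lemma clos_rt_map (R : relation X) (S : relation Y) (F : X -> Y) :
  (forall x y, R x y -> S (F x) (F y)) ->
  forall x y, clos_refl_trans X R x y -> clos_refl_trans Y S (F x) (F y).
Proof.
  intros H x y Hxy; induction Hxy; [apply rt_step, H; auto | apply rt_refl |].
  eapply rt_trans; eassumption.
Qed.

Lemma clos_rst_map (R : relation X) (S : relation Y) (F : X -> Y) :
  (forall x y, R x y -> S (F x) (F y)) ->
  forall x y,
    clos_refl_sym_trans X R x y -> clos_refl_sym_trans Y S (F x) (F y).
Proof.
  intros H x y Hxy; induction Hxy.
  - apply rst_step, H; auto.
  - apply rst_refl.
  - apply rst_sym; assumption.
  - eapply rst_trans; eassumption.
Qed.

End Vectors.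

Lemma confluent_church_rosser X (R : relation X) :
  confluent R -> forall x y, clos_refl_sym_trans X R x y ->
  exists z, clos_refl_trans X R x z /\ clos_refl_trans X R y z.
Proof.
  intros HR x y H; induction H as [x y H|x|x y _ (z & Hx & Hy)
    |x y t _ (z & Hx & Hy) _ (z' & Hy' & Ht)].
  - exists y; split; [apply rt_step, H | apply rt_refl].
  - exists x; split; apply rt_refl.
  - exists z; auto.
  - destruct (HR _ _ _ Hy Hy') as (u & Hu & Hu').
    exists u; split; eapply rt_trans; eassumption.
Qed.

(** [R] and [S] have the same reflexive transitive closure, and diamonds of [S] tile: first one step
    against many ([strip]), then many against many. *)
Lemma diamond_confluent X (R S : relation X) :
  (forall x y, R x y -> S x y) ->
  (forall x y, S x y -> clos_refl_trans X R x y) ->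
  (forall x y z, S x y -> S x z -> exists t, S y t /\ S z t) ->
  confluent R.
Proof.
  intros HRS HSR HS.
  assert (Hin : forall x y, clos_refl_trans X R x y -> clos_refl_trans_1n X S x y).
  { intros x y H; apply clos_rt_rt1n, (clos_rt_map (F := fun x => x) HRS H). }
  assert (Hout : forall x y, clos_refl_trans_1n X S x y -> clos_refl_trans X R x y).
  { intros x y H; induction H; [apply rt_refl | eapply rt_trans; eauto]. }
  assert (strip : forall x y, clos_refl_trans_1n X S x y -> forall z, S x z ->
            exists t, S y t /\ clos_refl_trans_1n X S z t).
  { intros x y H; induction H as [x|x y y' Hxy _ IH]; intros z Hz.
    - exists z; split; [exact Hz | apply rt1n_refl].
    - destruct (HS _ _ _ Hxy Hz) as (t & Ht & Ht').
      destruct (IH _ Ht) as (u & Hu & Hu').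
      exists u; split; [exact Hu | econstructor; eassumption]. }
  intros x y z Hy Hz; apply Hin in Hy; apply Hin in Hz; revert z Hz.
  induction Hy as [x|x y y' Hxy _ IH]; intros z Hz.
  - exists z; split; [apply Hout, Hz | apply rt_refl].
  - destruct (strip _ _ Hz _ Hxy) as (t & Ht & Ht').
    destruct (IH _ Ht') as (u & Hu & Hu').
    exists u; split; [exact Hu | eapply rt_trans; eauto].
Qed.

(** * Substitution *)

Section TermInduction.
Variables (K : arities) (Q : term K -> Prop).
Hypothesis HVar : forall x, Q (Var x).
Hypothesis HCst : forall c v, (forall i, Q (Vector.nth v i)) -> Q (Cst c v).
Hypothesis HSrt : forall s, Q (Srt s).
Hypothesis HPi : forall A B, Q A -> Q B -> Q (Pi A B).
Hypothesis HLam : forall A M, Q A -> Q M -> Q (Lam A M).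
Hypothesis HApp : forall M N, Q M -> Q N -> Q (App M N).

(** The generated principle has no hypothesis for the arguments of a constant, which are nested in a
    vector; the inner induction on that vector provides it. *)
Lemma term_nested_ind : forall M, Q M.
Proof.
  fix IH 1; intros [x|c v|s|A B|A M|M N].
  - apply HVar.
  - apply HCst.
    induction v as [|a n v IHv]; intros i.
    + pattern i; apply Fin.case0.
    + pattern i; apply Fin.caseS'; [apply IH | exact IHv].
  - apply HSrt.
  - apply HPi; apply IH.
  - apply HLam; apply IH.
  - apply HApp; apply IH.
Qed.

End TermInduction.

Section SubstitutionCalculus.
Variable K : arities.
Implicit Types (M N A B : term K) (f g : nat -> term K) (r : nat -> nat).

Lemma subst_ext M : forall f g, (forall x, f x = g x) -> subst f M = subst g M.
Proof.
  assert (Hup : forall f g, (forall x, f x = g x) -> forall x, up f x = up g x).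
  { intros f g H [|x]; simpl; [|rewrite H]; reflexivity. }
  induction M using term_nested_ind; intros f g E; simpl; auto; f_equal; auto.
  apply vector_map_eq; auto.
Qed.

Lemma ren_subst_Var M : forall r, ren r M = subst (fun x => Var (r x)) M.
Proof.
  assert (Hup : forall r x, up (fun x => Var (r x)) x = Var (upren r x) :> term K).
  { intros r [|x]; reflexivity. }
  induction M using term_nested_ind; intros r; simpl; auto; f_equal; auto.
  - apply vector_map_eq; auto.
  - rewrite IHM2; apply subst_ext; auto.
  - rewrite IHM2; apply subst_ext; auto.
Qed.

(** Since [up] itself renames, the laws mixing renamings and substitutions have to precede the
    composition of two substitutions. *)
Lemma ren_ext r r' M : (forall x, r x = r' x) -> ren r M = ren r' M.
Proof. intros E; rewrite !ren_subst_Var; apply subst_ext; intros x; rewrite E; auto. Qed.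

Lemma subst_Var M : subst Var M = M.
Proof.
  assert (Hup : forall f, (forall x, f x = Var x) -> forall x, up f x = Var x).
  { intros f E [|x]; simpl; [|rewrite E]; reflexivity. }
  enough (H : forall f, (forall x, f x = Var x) -> subst f M = M) by auto.
  induction M using term_nested_ind; intros f E; simpl; auto; f_equal; auto.
  rewrite <- (Vector.map_id _ _ v) at 2; apply vector_map_eq; auto.
Qed.

Lemma subst_ren M : forall f r, subst f (ren r M) = subst (fun x => f (r x)) M.
Proof.
  induction M using term_nested_ind; intros f r; simpl; auto; f_equal; auto.
  - rewrite Vector.map_map; apply vector_map_eq; auto.
  - rewrite IHM2; apply subst_ext; intros [|x]; reflexivity.
  - rewrite IHM2; apply subst_ext; intros [|x]; reflexivity.
Qed.

Lemma ren_ren r r' M : ren r (ren r' M) = ren (fun x => r (r' x)) M.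
Proof. rewrite !(ren_subst_Var _ r), subst_ren, ren_subst_Var; reflexivity. Qed.

Lemma ren_subst M : forall f r, ren r (subst f M) = subst (fun x => ren r (f x)) M.
Proof.
  assert (Hup : forall f r x, ren (upren r) (up f x) = up (fun x => ren r (f x)) x).
  { intros f r [|x]; simpl; [|rewrite !ren_ren]; reflexivity. }
  induction M using term_nested_ind; intros f r; simpl; auto; f_equal; auto.
  - rewrite Vector.map_map; apply vector_map_eq; auto.
  - rewrite IHM2; apply subst_ext; auto.
  - rewrite IHM2; apply subst_ext; auto.
Qed.

Lemma subst_up_up f g x : subst (up g) (up f x) = up (fun x => subst g (f x)) x.
Proof. destruct x; simpl; [|rewrite subst_ren, ren_subst]; reflexivity. Qed.

Lemma subst_subst M : forall f g, subst g (subst f M) = subst (fun x => subst g (f x)) M.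
Proof.
  induction M using term_nested_ind; intros f g; simpl; auto; f_equal; auto.
  - rewrite Vector.map_map; apply vector_map_eq; auto.
  - rewrite IHM2; apply subst_ext, subst_up_up.
  - rewrite IHM2; apply subst_ext, subst_up_up.
Qed.

(** Unlike [inst], which ends in lowered variables, this extends an arbitrary substitution: the form
    that appears when a body under [up f] is instantiated. *)
Definition scons N f (x : nat) : term K :=
  match x with 0 => N | S y => f y end.

Lemma inst_scons Ms N x : inst (N :: Ms) x = scons N (inst Ms) x.
Proof. destruct x; reflexivity. Qed.

Lemma inst_nil x : inst [] x = Var x :> term K.
Proof. unfold inst; simpl; rewrite Nat.sub_0_r; destruct x; reflexivity. Qed.

Lemma subst0_scons N M : subst0 N M = subst (scons N Var) M.
Proof.
  apply subst_ext; intros x; rewrite inst_scons; destruct x; [reflexivity|].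
  apply inst_nil.
Qed.

Lemma subst0_up N f M : subst0 N (subst (up f) M) = subst (scons N f) M.
Proof.
  rewrite subst0_scons, subst_subst; apply subst_ext; intros [|x]; simpl; auto.
  rewrite subst_ren; apply subst_Var.
Qed.

Lemma subst_subst0 f N M :
  subst f (subst0 N M) = subst0 (subst f N) (subst (up f) M).
Proof.
  rewrite subst0_up, subst0_scons, subst_subst; apply subst_ext.
  intros [|x]; reflexivity.
Qed.

Lemma ctx_closure_subst (R : relation (term K)) :
  (forall f M N, R M N -> R (subst f M) (subst f N)) ->
  forall M N, ctx_closure R M N ->
  forall f, ctx_closure R (subst f M) (subst f N).
Proof.
  intros HR M N H; induction H; intros f; simpl; try (constructor; auto; fail).
  rewrite vector_map_replace; apply cc_Cst.
  rewrite (Vector.nth_map _ _ _ _ eq_refl); auto.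
Qed.

Lemma beta_head_subst f M N :
  beta_head M N -> beta_head (subst f M) (subst f N).
Proof. intros [A M' N']; simpl; rewrite subst_subst0; constructor. Qed.

Lemma beta_subst f M N : beta M N -> beta (subst f M) (subst f N).
Proof. intros H; apply (ctx_closure_subst beta_head_subst H). Qed.

(** Plain inversion would leave an equality of dependent pairs over [c], in a type without decidable
    equality. Matching on a general left-hand side avoids it. *)
Lemma ctx_closure_Cst_inv (R : relation (term K)) c v M :
  (forall N, ~ R (Cst c v) N) ->
  ctx_closure R (Cst c v) M ->
  exists w, M = Cst c w /\ vector_step (ctx_closure R) v w.
Proof.
  enough (H : forall N, ctx_closure R N M ->
    match N with
    | Cst c v => (forall N', ~ R (Cst c v) N') ->
        exists w, M = Cst c w /\ vector_step (ctx_closure R) v w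
    | _ => True
    end) by (intros; apply (H (Cst c v)); auto).
  intros N H; destruct H as [N M H|c' v' i a H| | | | | |]; auto.
  - destruct N; auto; intros H'; exfalso; apply (H' _ H).
  - intros _; eexists; split; [reflexivity|]; exists i, a; auto.
Qed.

Lemma ctx_closure_replace (R : relation (term K)) c v i M N :
  ctx_closure R M N ->
  ctx_closure R (Cst c (Vector.replace v i M)) (Cst c (Vector.replace v i N)).
Proof.
  (* [cc_Cst] starts from the vector that already holds [M] at [i], so the target is viewed as a
     second replacement at the same place. *)
  intros H; rewrite <- (Vector.replace_replace_eq _ _ i v M N).
  apply cc_Cst; rewrite Vector.nth_replace_eq; exact H.
Qed.

End SubstitutionCalculus.

(** * Congruences *)

Section Congruences.
Variable K : arities.
Implicit Types (M N A B : term K) (f g : nat -> term K) (R E : relation (term K)).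

(** A semantic notion of one-hole context. Quantifying over [R] makes it apply to beta and to
    rewriting alike, so one development of congruences serves reductions and conversion. *)
Definition one_hole (F : term K -> term K) : Prop :=
  forall R M N, ctx_closure R M N -> ctx_closure R (F M) (F N).

Definition compatible R : Prop :=
  forall F, one_hole F -> forall M N, R M N -> R (F M) (F N).

Record congruence E : Prop := Congruence {
  cong_refl : forall M, E M M;
  cong_trans : forall M N Q, E M N -> E N Q -> E M Q;
  cong_compat : compatible E
}.

Lemma congruence_clos_rt R : compatible R -> congruence (clos_refl_trans _ R).
Proof.
  intros HR; split; [apply rt_refl | apply rt_trans |].
  intros F HF; apply clos_rt_map, HR, HF.
Qed.

Lemma congruence_clos_rst R : compatible R -> congruence (clos_refl_sym_trans _ R).
Proof.
  intros HR; split; [apply rst_refl | apply rst_trans |].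
  intros F HF; apply clos_rst_map, HR, HF.
Qed.

Lemma compatible_beta : compatible (@beta K).
Proof. intros F HF M N; apply HF. Qed.

Lemma compatible_beta_rew (T : theory K) : compatible (beta_rew T).
Proof. intros F HF M N [H|H]; [left|right]; apply HF, H. Qed.

Section Congruence.
Variable E : relation (term K).
Hypothesis HE : congruence E.

Lemma cong_Cst c v w :
  (forall i, E (Vector.nth v i) (Vector.nth w i)) -> E (Cst c v) (Cst c w).
Proof.
  apply (vector_pointwise_chain (E := fun v w => E (Cst c v) (Cst c w))); clear v w.
  - intros; apply (cong_refl HE).
  - intros; eapply (cong_trans HE); eassumption.
  - intros v i a H; rewrite <- (Vector.replace_id _ _ i v) at 1.
    apply (cong_compat HE (F := fun X => Cst c (Vector.replace v i X))); auto.
    intros R M N; apply ctx_closure_replace.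
Qed.

Lemma cong_Pi A A' B B' : E A A' -> E B B' -> E (Pi A B) (Pi A' B').
Proof.
  intros HA HB; apply (cong_trans HE) with (Pi A' B).
  - apply (cong_compat HE (F := fun X => Pi X B)); auto.
    intros R M N; apply cc_Pi_l.
  - apply (cong_compat HE); auto; intros R M N; apply cc_Pi_r.
Qed.

Lemma cong_Lam A A' M M' : E A A' -> E M M' -> E (Lam A M) (Lam A' M').
Proof.
  intros HA HM; apply (cong_trans HE) with (Lam A' M).
  - apply (cong_compat HE (F := fun X => Lam X M)); auto.
    intros R N N'; apply cc_Lam_l.
  - apply (cong_compat HE); auto; intros R N N'; apply cc_Lam_r.
Qed.

Lemma cong_App M M' N N' : E M M' -> E N N' -> E (App M N) (App M' N').
Proof.
  intros HM HN; apply (cong_trans HE) with (App M' N).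
  - apply (cong_compat HE (F := fun X => App X N)); auto.
    intros R Q Q'; apply cc_App_l.
  - apply (cong_compat HE); auto; intros R Q Q'; apply cc_App_r.
Qed.

(** Stability of [E] under renaming is what carries the pointwise assumption through [up]. *)
Lemma cong_subst_pointwise M :
  (forall r A B, E A B -> E (ren r A) (ren r B)) ->
  forall f g, (forall x, E (f x) (g x)) -> E (subst f M) (subst g M).
Proof.
  intros Hren.
  assert (Hup : forall f g, (forall x, E (f x) (g x)) -> forall x, E (up f x) (up g x)).
  { intros f g H [|x]; [apply (cong_refl HE) | apply Hren, H]. }
  induction M using term_nested_ind; intros f g H'; simpl; auto.
  - apply cong_Cst; intros i; rewrite !(Vector.nth_map _ _ _ _ eq_refl); auto.
  - apply (cong_refl HE).
  - apply cong_Pi; auto.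
  - apply cong_Lam; auto.
  - apply cong_App; auto.
Qed.

End Congruence.

Lemma beta_steps_subst_pointwise M f g :
  (forall x, clos_refl_trans _ (@beta K) (f x) (g x)) ->
  clos_refl_trans _ (@beta K) (subst f M) (subst g M).
Proof.
  apply (cong_subst_pointwise (congruence_clos_rt compatible_beta)).
  intros r A B; rewrite !ren_subst_Var; apply clos_rt_map; intros; apply beta_subst; auto.
Qed.

Variable T : theory K.

Lemma congruence_conv : congruence (conv T).
Proof. apply congruence_clos_rst, compatible_beta_rew. Qed.

Lemma beta_rew_subst f M N :
  beta_rew T M N -> beta_rew T (subst f M) (subst f N).
Proof.
  intros [H|H]; [left; apply beta_subst, H | right].
  apply (ctx_closure_subst (R := rew_head T)); auto.
  intros g _ _ [l r h Hl]; rewrite !subst_subst; constructor; exact Hl.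
Qed.

Lemma conv_subst f A B : conv T A B -> conv T (subst f A) (subst f B).
Proof. apply clos_rst_map; intros; apply beta_rew_subst; auto. Qed.

Lemma conv_ren r A B : conv T A B -> conv T (ren r A) (ren r B).
Proof. rewrite !ren_subst_Var; apply conv_subst. Qed.

Lemma conv_beta M N : beta M N -> conv T M N.
Proof. intros H; apply rst_step; left; exact H. Qed.

End Congruences.

(** * Subject reduction *)

Scheme typing_minimality := Minimality for typing Sort Prop
  with wf_minimality := Minimality for wf Sort Prop
  with typing_args_minimality := Minimality for typing_args Sort Prop.
Combined Scheme typing_wf_args_ind
  from typing_minimality, wf_minimality, typing_args_minimality.

(** Counterpart of [vector_step] on lists, since [typing_args] and [inst] take the arguments as a
    reversed list. *)
Inductive list_step (X : Type) (R : relation X) : relation (list X) :=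
| list_step_head x y l : R x y -> list_step R (x :: l) (y :: l)
| list_step_tail x l l' : list_step R l l' -> list_step R (x :: l) (x :: l').

Lemma list_step_app X (R : relation X) l l' k :
  list_step R l l' -> list_step R (l ++ k) (l' ++ k).
Proof. intros H; induction H; simpl; constructor; auto. Qed.

Lemma list_step_prepend X (R : relation X) k l l' :
  list_step R l l' -> list_step R (k ++ l) (k ++ l').
Proof. intros H; induction k; simpl; [|constructor]; auto. Qed.

Lemma list_step_rev X (R : relation X) l l' :
  list_step R l l' -> list_step R (rev l) (rev l').
Proof.
  intros H; induction H; simpl.
  - apply list_step_prepend; constructor; auto.
  - apply list_step_app; auto.
Qed.

Lemma vector_step_to_list X (R : relation X) n (v w : Vector.t X n) :
  vector_step R v w -> list_step R (Vector.to_list v) (Vector.to_list w).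
Proof.
  intros (i & a & H & ->); revert H; induction v as [|b n v IH].
  - pattern i; apply Fin.case0.
  - pattern i; apply Fin.caseS'; simpl.
    + intros H; apply list_step_head, H.
    + intros j H; apply list_step_tail, IH, H.
Qed.

Lemma list_step_nth X (R : relation X) l l' d x :
  list_step R l l' -> clos_refl_sym_trans X R (nth x l d) (nth x l' d).
Proof.
  intros H; revert x; induction H; intros [|n]; simpl; auto.
  - apply rst_step; auto.
  - apply rst_refl.
  - apply rst_refl.
Qed.

Lemma list_step_length X (R : relation X) l l' :
  list_step R l l' -> length l = length l'.
Proof. intros H; induction H; simpl; auto. Qed.

Section SubjectReduction.
Variables (K : arities) (T : theory K).
Implicit Types (G D : ctx K) (M N A B : term K) (f g : nat -> term K).

Lemma typing_wf_context :
  (forall G M A, typing T G M A -> wf T G) /\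
  (forall G, wf T G -> wf T G) /\
  (forall G Ms D, typing_args T G Ms D -> wf T G).
Proof.
  apply typing_wf_args_ind; auto; intros; constructor; auto.
Qed.

Lemma typing_wf G M A : typing T G M A -> wf T G.
Proof. apply typing_wf_context. Qed.

(* Expresses that well-typed terms are scoped by their context. *)
Lemma typing_subst_agree :
  (forall G M A, typing T G M A -> forall f g,
     (forall x, x < length G -> f x = g x) -> subst f M = subst g M) /\
  (forall G, wf T G -> True) /\
  (forall G Ms D, typing_args T G Ms D -> forall f g,
     (forall x, x < length G -> f x = g x) ->
     List.map (subst f) Ms = List.map (subst g) Ms).
Proof.
  assert (Hup : forall G f g, (forall x, x < length G -> f x = g x) ->
    forall x, x < S (length G) -> up f x = up g x).
  { intros G f g H [|x] Hx; simpl in *; [|rewrite H by lia]; reflexivity. }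
  apply typing_wf_args_ind; simpl; auto.
  - intros G x A _ _ Hx f g E; apply E, nth_error_Some; congruence.
  - intros G c v D A _ _ IH f g E; f_equal.
    apply Vector.to_list_inj; rewrite !Vector.to_list_map.
    specialize (IH f g E); apply (f_equal (@rev _)) in IH.
    rewrite <- !map_rev, rev_involutive in IH; exact IH.
  - intros; f_equal; eauto.
  - intros; f_equal; eauto.
  - intros; f_equal; eauto.
  - intros; f_equal; eauto.
Qed.

Lemma typing_args_length G Ms D : typing_args T G Ms D -> length Ms = length D.
Proof. intros H; induction H; simpl; auto. Qed.

(** Typing of [A] in [D] ensures that only indices below [length Ms] matter: beyond them one side
    applies [f] and the other does not. *)
Lemma subst_inst_commute D A s f Ms :
  typing T D A s -> length Ms = length D ->
  subst f (subst (inst Ms) A) = subst (inst (List.map (subst f) Ms)) A.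
Proof.
  intros HA Hl; rewrite subst_subst.
  apply (proj1 typing_subst_agree _ _ _ HA); intros x Hx; unfold inst.
  (* In range the default is irrelevant; it is changed to an image under [subst f] so that [map_nth]
     applies. *)
  rewrite nth_indep with (d := Var (x - length (List.map (subst f) Ms)))
                         (d' := subst f (Var (x - length Ms)))
    by (rewrite length_map; lia).
  symmetry; apply map_nth.
Qed.

(** Makes declared types scoped and their contexts well-formed, and types the target when the
    instance of a declared type is converted. *)
Hypothesis decl_typed : forall c D A, decl T c D A ->
  exists s, typing T D A (Srt s).

Lemma decl_wf c D A : decl T c D A -> wf T D.
Proof. intros H; destruct (decl_typed H) as [s Hs]; eapply typing_wf, Hs. Qed.

Lemma rev_to_list_map f n (v : Vector.t (term K) n) :
  rev (Vector.to_list (Vector.map (subst f) v)) =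
  List.map (subst f) (rev (Vector.to_list v)).
Proof. rewrite Vector.to_list_map, map_rev; reflexivity. Qed.

(* Renaming and substitution differ only in the premise on variables and in
   its stability under binders. *)
Section GenericSubstitution.
Variable ok : ctx K -> ctx K -> (nat -> term K) -> Prop.
Hypothesis ok_var : forall D G f, ok D G f -> wf T G ->
  forall x C, nth_error D x = Some C ->
  typing T G (f x) (subst f (ren (fun y => S x + y) C)).
Hypothesis ok_up : forall D G f A, ok D G f ->
  wf T (subst f A :: G) -> ok (A :: D) (subst f A :: G) (up f).

(** The clause on arguments assumes [wf T E]: inverting it types each declared type in its own
    prefix, which allows the substitution to pass through [inst]. *)
Lemma typing_subst_generic :
  (forall D M A, typing T D M A -> forall G f, wf T G -> ok D G f ->
     typing T G (subst f M) (subst f A)) /\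
  (forall D, wf T D -> True) /\
  (forall D Ms E, typing_args T D Ms E -> wf T E ->
     forall G f, wf T G -> ok D G f ->
     typing_args T G (List.map (subst f) Ms) E).
Proof.
  apply typing_wf_args_ind; simpl; auto.
  - intros; constructor; auto.
  - intros D x A _ _ Hx G f HG Hf; apply (ok_var Hf HG Hx).
  - intros D c v E A Hd Ha IH G f HG Hf.
    destruct (decl_typed Hd) as [s Hs].
    rewrite (subst_inst_commute _ Hs (typing_args_length Ha)), <- rev_to_list_map.
    apply t_cst with E; auto; rewrite rev_to_list_map.
    apply IH; auto; eapply decl_wf; eauto.
  - intros D A B s _ IHA _ IHB G f HG Hf.
    assert (HA : wf T (subst f A :: G)) by (constructor; auto).
    constructor; auto.
  - intros D A B M s _ IHA _ IHB _ IHM G f HG Hf.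
    assert (HA : wf T (subst f A :: G)) by (constructor; auto).
    apply t_lam with s; auto.
  - intros D A B M N _ IHM _ IHN G f HG Hf.
    rewrite subst_subst0; apply t_app with (subst f A); auto.
  - intros D M A B s _ IHM _ IHB HAB G f HG Hf.
    apply t_conv with (subst f A) s; auto; apply conv_subst, HAB.
  - intros; constructor; auto.
  - intros D Ms E M A Ha IHa _ IHM HE G f HG Hf.
    inversion HE as [|? ? HE' HA]; subst.
    constructor; auto.
    rewrite <- (subst_inst_commute _ HA (typing_args_length Ha)); auto.
Qed.

End GenericSubstitution.

(** Declared types are compared after being lifted to the whole context, where both sides live in
    [G]. *)
Definition renaming D G f : Prop :=
  exists r, (forall x, f x = Var (r x)) /\
  forall x C, nth_error D x = Some C ->
  exists C', nth_error G (r x) = Some C' /\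
    ren (fun y => S (r x) + y) C' = ren r (ren (fun y => S x + y) C).

Lemma typing_ren D M A G r :
  typing T D M A -> wf T G -> renaming D G (fun x => Var (r x)) ->
  typing T G (ren r M) (ren r A).
Proof.
  intros HM HG Hr; rewrite !ren_subst_Var; revert HM HG Hr.
  refine (fun H HG Hr => proj1 (@typing_subst_generic renaming _ _) D M A H G _ HG Hr); clear.
  - intros D G f (r & Hf & H) HG x C Hx; destruct (H x C Hx) as (C' & Hx' & E).
    rewrite (subst_ext _ (g := fun x => Var (r x))), <- ren_subst_Var, <- E, Hf by auto.
    apply t_var; auto.
  - intros D G f A (r & Hf & H) HG; exists (upren r); split.
    + intros [|x]; simpl; [|rewrite Hf]; reflexivity.
    + intros [|x] C Hx; simpl in *.
      * injection Hx as <-; eexists; split; [reflexivity|].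
        rewrite (subst_ext _ (g := fun x => Var (r x))), <- ren_subst_Var by auto.
        rewrite !ren_ren; apply ren_ext; intros; simpl; reflexivity.
      * destruct (H x C Hx) as (C' & Hx' & E); exists C'; split; auto.
        apply (f_equal (ren S)) in E; rewrite !ren_ren in E; rewrite ren_ren.
        exact E.
Qed.

Lemma typing_weaken G M A B :
  typing T G M A -> wf T (B :: G) -> typing T (B :: G) (ren S M) (ren S A).
Proof.
  intros H HB; apply (typing_ren H HB).
  exists S; split; auto; intros x C Hx; exists C; split; auto.
  rewrite ren_ren; reflexivity.
Qed.

Lemma wf_nth_typed G x A :
  wf T G -> nth_error G x = Some A ->
  typing T G (ren (fun y => S x + y) A) (Srt TYPE).
Proof.
  intros H; revert x; induction H as [|G B HG IH HB]; intros [|x] Hx; simpl in Hx;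
    try discriminate.
  - injection Hx as <-; apply (typing_weaken HB); constructor; auto.
  - replace (ren _ A) with (ren S (ren (fun y => S x + y) A))
      by (rewrite ren_ren; reflexivity).
    apply (typing_weaken (A := Srt TYPE)); [auto | constructor; auto].
Qed.

(** Going under a binder weakens the images of the variables, so this instance of the generic lemma
    relies on weakening, obtained from the renaming instance. *)
Definition substitution D G f : Prop :=
  forall x C, nth_error D x = Some C ->
  typing T G (f x) (subst f (ren (fun y => S x + y) C)).

Lemma substitution_typing :
  (forall D M A, typing T D M A -> forall G f, wf T G -> substitution D G f ->
     typing T G (subst f M) (subst f A)) /\
  (forall D, wf T D -> True) /\
  (forall D Ms E, typing_args T D Ms E -> wf T E ->
     forall G f, wf T G -> substitution D G f ->
     typing_args T G (List.map (subst f) Ms) E).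
Proof.
  apply typing_subst_generic; [auto|].
  intros D G f A Hf HA [|x] C Hx; simpl in Hx.
  - injection Hx as <-.
    replace (subst (up f) _) with (ren (fun y => S 0 + y) (subst f A)).
    + apply t_var; auto.
    + rewrite ren_subst, subst_ren; apply subst_ext; reflexivity.
  - replace (subst (up f) _) with (ren S (subst f (ren (fun y => S x + y) C))).
    + apply typing_weaken; auto.
    + rewrite !subst_ren, ren_subst; apply subst_ext; reflexivity.
Qed.

Lemma typing_subst D M A G f :
  typing T D M A -> wf T G -> substitution D G f ->
  typing T G (subst f M) (subst f A).
Proof. intros H; apply (proj1 substitution_typing _ _ _ H). Qed.

Lemma typing_subst0 G M A B N :
  typing T (B :: G) M A -> typing T G N B ->
  typing T G (subst0 N M) (subst0 N A).
Proof.
  intros HM HN; pose proof (typing_wf HN) as HG.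
  rewrite !subst0_scons; apply (typing_subst HM HG).
  intros [|x] C Hx; simpl in Hx; rewrite subst_ren; simpl.
  - injection Hx as <-; rewrite subst_Var; exact HN.
  - rewrite <- ren_subst_Var; apply t_var; auto.
Qed.

(** [typing_args] types each argument in a type instantiated by the earlier ones, which is exactly
    the condition for [inst Ms] to be a well-typed substitution from [D] to [G]. *)
Lemma typing_inst G Ms D M A :
  typing_args T G Ms D -> typing T D M A ->
  typing T G (subst (inst Ms) M) (subst (inst Ms) A).
Proof.
  intros Ha HM; apply (typing_subst HM).
  - apply (proj2 (proj2 typing_wf_context) _ _ _ Ha).
  - clear HM; induction Ha as [G HG|G Ms D N B Ha IH HN].
    + intros [|x] C; discriminate.
    + intros [|x] C Hx; simpl in Hx; rewrite subst_ren, inst_scons; simpl.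
      * injection Hx as <-; exact HN.
      * specialize (IH x C Hx); rewrite subst_ren in IH; exact IH.
Qed.

(** The identity is a well-typed substitution from [A :: G] to [A' :: G]: variable 0 gets its old
    type by conversion, the others keep theirs. *)
Lemma typing_ctx_conv G A A' M B :
  typing T (A :: G) M B -> typing T G A' (Srt TYPE) -> conv T A A' ->
  typing T (A' :: G) M B.
Proof.
  intros HM HA' HAA'.
  assert (HG : wf T (A :: G)) by (eapply typing_wf, HM).
  assert (HG' : wf T (A' :: G)) by (constructor; auto; eapply typing_wf, HA').
  inversion HG as [|? ? _ HA]; subst.
  rewrite <- (subst_Var M), <- (subst_Var B); apply (typing_subst HM HG').
  intros [|x] C Hx; simpl in Hx; rewrite subst_Var.
  - injection Hx as <-; apply t_conv with (ren (fun y => 1 + y) A') TYPE.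
    + apply t_var; auto.
    + apply (typing_weaken HA HG').
    + apply conv_ren, rst_sym, HAA'.
  - apply t_var; auto.
Qed.

(** * Inversion of typing, and typability of types *)

Lemma typing_Pi_inv G A B C :
  typing T G (Pi A B) C ->
  typing T G A (Srt TYPE) /\ exists s, typing T (A :: G) B (Srt s).
Proof.
  remember (Pi A B) as M eqn:E; intros H; revert A B E.
  induction H; intros; try discriminate; eauto.
  injection E as <- <-; eauto.
Qed.

Lemma typing_Lam_inv G A M C :
  typing T G (Lam A M) C ->
  exists B s, typing T G A (Srt TYPE) /\ typing T (A :: G) B (Srt s) /\
    typing T (A :: G) M B /\ conv T (Pi A B) C.
Proof.
  remember (Lam A M) as N eqn:E; intros H; revert A M E.
  induction H as [| | | |G A B M s HA _ HB _ HM _| |G M A B s _ IH _ _ HAB];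
    intros; try discriminate.
  - injection E as <- <-; exists B, s; repeat split; auto; apply rst_refl.
  - destruct (IH _ _ E) as (B' & s' & H1 & H2 & H3 & H4).
    exists B', s'; repeat split; auto; eapply rst_trans; eassumption.
Qed.

Lemma typing_type_typed G M A :
  typing T G M A -> A = Srt KIND \/ exists s, typing T G A (Srt s).
Proof.
  intros H; induction H as [G HG|G x A HG Hx|G c v D A Hd Ha|G A B s HA _ HB _
    |G A B M s HA _ HB _ HM _|G A B M N HM IHM HN _|G M A B s _ _ HB _ _].
  - auto.
  - right; exists TYPE; apply wf_nth_typed; auto.
  - right; destruct (decl_typed Hd) as [s Hs]; exists s.
    apply (typing_inst Ha Hs).
  - destruct s; [right; exists KIND; constructor; eapply typing_wf, HA | auto].
  - right; exists s; constructor; auto.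
  - right; destruct IHM as [E|[s HP]]; [discriminate|].
    destruct (typing_Pi_inv HP) as (_ & s' & HB); exists s'.
    apply (typing_subst0 HB HN).
  - right; exists s; auto.
Qed.

(** Needed when a beta redex is contracted, to compare the product inferred for the abstraction with
    the one used by the application. *)
Hypothesis conv_Pi_inj : forall A B A' B',
  conv T (Pi A B) (Pi A' B') -> conv T A A' /\ conv T B B'.

Lemma typing_beta_head G M N A A' B' :
  typing T G (Lam A M) (Pi A' B') -> typing T G N A' ->
  typing T G (subst0 N M) (subst0 N B').
Proof.
  intros H HN.
  destruct (typing_Lam_inv H) as (C & s & HA & HC & HM & HAC).
  destruct (conv_Pi_inj HAC) as [HAA' HCB'].
  destruct (typing_type_typed H) as [E|[s' HP]]; [discriminate|].
  destruct (typing_Pi_inv HP) as (_ & s'' & HB').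
  apply t_conv with (subst0 N C) s''.
  - apply typing_subst0 with A; auto.
    apply t_conv with A' TYPE; auto; apply rst_sym; auto.
  - apply (typing_subst0 HB' HN).
  - apply conv_subst, HCB'.
Qed.

Lemma conv_inst_list_step Ms Ms' A :
  list_step (@beta K) Ms Ms' ->
  conv T (subst (inst Ms) A) (subst (inst Ms') A).
Proof.
  intros H; apply (cong_subst_pointwise (congruence_conv T)).
  { intros r M N; apply conv_ren. }
  intros x; unfold inst.
  (* Equal lengths make the default values of the two lookups coincide. *)
  rewrite (list_step_length H).
  apply (clos_rst_map (F := fun X => X) (R := @beta K)).
  - intros M N HMN; left; exact HMN.
  - apply list_step_nth, H.
Qed.

Lemma conv_subst0_beta N N' B :
  beta N N' -> conv T (subst0 N B) (subst0 N' B).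
Proof. intros H; apply conv_inst_list_step; constructor; exact H. Qed.

Lemma beta_Cst_inv c (v : Vector.t (term K) (ar c)) M :
  beta (Cst c v) M -> exists w, M = Cst c w /\ vector_step (@beta K) v w.
Proof. apply ctx_closure_Cst_inv; intros N H; inversion H. Qed.

(** A step in a domain changes the context, which [typing_ctx_conv] repairs. A step in an argument,
    of an application or of a constant, changes the type of the result or the types expected of
    later arguments, but only up to conversion. *)
Lemma typing_beta_args :
  (forall G M A, typing T G M A -> forall M', beta M M' -> typing T G M' A) /\
  (forall G, wf T G -> True) /\
  (forall G Ms D, typing_args T G Ms D -> wf T D -> forall Ms',
     list_step (@beta K) Ms Ms' -> typing_args T G Ms' D).
Proof.
  apply typing_wf_args_ind; auto.
  - intros G _ _ M' H; inversion H; inversion H0.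
  - intros G x A _ _ _ M' H; inversion H; inversion H0.
  - intros G c v D A Hd Ha IH M' H.
    destruct (beta_Cst_inv H) as (w & -> & Hw).
    apply vector_step_to_list, list_step_rev in Hw.
    destruct (decl_typed Hd) as [s Hs].
    apply t_conv with (subst (inst (rev (Vector.to_list w))) A) s.
    + apply t_cst with D; auto; apply IH; auto; eapply decl_wf; eauto.
    + apply (typing_inst Ha Hs).
    + apply rst_sym, conv_inst_list_step, Hw.
  - intros G A B s HA IHA HB IHB M' H; inversion H; subst.
    + inversion H0.
    + constructor; auto; apply typing_ctx_conv with A; auto.
      apply conv_beta; auto.
    + constructor; auto.
  - intros G A B M s HA IHA HB IHB HM IHM M' H; inversion H; subst.
    + inversion H0.
    + assert (conv T A A') by (apply conv_beta; auto).
      apply t_conv with (Pi A' B) s.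
      * apply t_lam with s; auto; apply typing_ctx_conv with A; auto.
      * constructor; auto.
      * apply (cong_Pi (congruence_conv T)); [apply rst_sym; auto | apply rst_refl].
    + apply t_lam with s; auto.
  - intros G A B M N HM IHM HN IHN M' H.
    pose proof (t_app HM HN) as HMN; inversion H; subst.
    + inversion H0; subst; eapply typing_beta_head; eauto.
    + apply t_app with A; auto.
    + destruct (typing_type_typed HM) as [E|[s HP]]; [discriminate|].
      destruct (typing_Pi_inv HP) as (_ & s' & HB).
      apply t_conv with (subst0 N' B) s'.
      * apply t_app with A; auto.
      * apply (typing_subst0 HB HN).
      * apply rst_sym, conv_subst0_beta; auto.
  - intros G M A B s _ IH HB _ HAB M' H; apply t_conv with A s; auto.
  - intros G _ _ _ Ms' H; inversion H.
  - intros G Ms D M A Ha IHa HM IHM HD Ms' H.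
    inversion HD as [|? ? HD' HA]; subst; inversion H; subst.
    + constructor; auto.
    + constructor; auto; apply t_conv with (subst (inst Ms) A) TYPE; auto.
      * apply (typing_inst (IHa HD' _ H3) HA).
      * apply conv_inst_list_step; auto.
Qed.

Theorem subject_reduction_beta G M M' A :
  typing T G M A -> beta M M' -> typing T G M' A.
Proof. intros H; apply (proj1 typing_beta_args _ _ _ H). Qed.

End SubjectReduction.

(** * Reducibility for simple types *)

Inductive simple_type : Set := Base | Arrow (a b : simple_type).

Section Reducibility.
Variable K : arities.
Implicit Types (M N A B : term K) (t : simple_type).
Local Notation SN := (strongly_normalizing (@beta K)).

Fixpoint reducible t : term K -> Prop :=
  match t with
  | Base => strongly_normalizing (@beta K)
  | Arrow a b => fun M => forall N, reducible a N -> reducible b (App M N)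
  end.

(** For beta alone, only an abstraction becomes a redex when applied; constants count as neutral. *)
Definition neutral M : Prop := forall A N, M <> Lam A N.

(** [F] maps an infinite reduction of [M] to one of [F M]. *)
Lemma SN_preimage (F : term K -> term K) :
  (forall M N, beta M N -> beta (F M) (F N)) -> forall M, SN (F M) -> SN M.
Proof.
  intros HF M H; remember (F M) as N eqn:E; revert M E.
  induction H as [N _ IH]; intros M ->; constructor; intros M' HM.
  apply (IH (F M')); auto; apply HF, HM.
Qed.

Lemma SN_Pi A B : SN A -> SN B -> SN (Pi A B).
Proof.
  intros HA; revert B; induction HA as [A HA IHA]; intros B HB.
  induction HB as [B HB IHB]; constructor; intros M H; inversion H; subst.
  - inversion H0.
  - apply IHA; [auto | constructor; exact HB].
  - apply IHB; auto.
Qed.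

Lemma SN_Cst c (v : Vector.t (term K) (ar c)) :
  (forall i, SN (Vector.nth v i)) -> SN (Cst c v).
Proof.
  intros H; apply vector_strongly_normalizing in H.
  induction H as [v _ IH]; constructor; intros M HM.
  destruct (beta_Cst_inv HM) as (w & -> & Hw); apply IH, Hw.
Qed.

Lemma reducible_step t : forall M N, reducible t M -> beta M N -> reducible t N.
Proof.
  induction t as [|a _ b IHb]; simpl; intros M N HM H.
  - destruct HM as [HM]; apply HM, H.
  - intros Q HQ; apply (IHb (App M Q)); [auto | apply cc_App_l, H].
Qed.

Lemma reducible_steps t M N :
  reducible t M -> clos_refl_trans _ (@beta K) M N -> reducible t N.
Proof.
  intros HM H; revert HM; induction H; auto; intros; eapply reducible_step; eauto.
Qed.

(* Proved together: the first applies a term to a variable, which is reducible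
   by the second. *)
Lemma reducible_SN_neutral t :
  (forall M, reducible t M -> SN M) /\
  (forall M, neutral M -> (forall N, beta M N -> reducible t N) -> reducible t M).
Proof.
  induction t as [|a [IHa1 IHa2] b [IHb1 IHb2]]; simpl; split; auto.
  - intros M _ H; constructor; exact H.
  - intros M H; apply (SN_preimage (F := fun M => App M (Var 0))).
    + intros; apply cc_App_l; auto.
    + apply IHb1, H, IHa2; [intros A N E; discriminate|].
      intros N HN; inversion HN; inversion H0.
  - intros M HM H N HN; pose proof (IHa1 _ HN) as SN_N; revert HN.
    induction SN_N as [N _ IHN]; intros HN.
    apply IHb2; [intros A Q E; discriminate|].
    intros Q HQ; inversion HQ; subst.
    + inversion H0; subst; exfalso; eapply HM; reflexivity.
    + apply H; auto.
    + apply IHN; auto; eapply reducible_step; eauto.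
Qed.

Lemma reducible_SN t M : reducible t M -> SN M.
Proof. apply reducible_SN_neutral. Qed.

Lemma reducible_neutral t M :
  neutral M -> (forall N, beta M N -> reducible t N) -> reducible t M.
Proof. apply reducible_SN_neutral. Qed.

Lemma reducible_Var t x : reducible t (Var x).
Proof.
  apply reducible_neutral; [intros A N E; discriminate|].
  intros N HN; inversion HN; inversion H.
Qed.

(** The redex is neutral, so its one-step reducts suffice: the contractum, or a step in [A], [M] or
    [N], handled by nested inductions. Steps in the annotation [A] count too, hence [SN A]. *)
Lemma reducible_beta_expand t A M N :
  SN A -> SN M -> SN N -> reducible t (subst0 N M) -> reducible t (App (Lam A M) N).
Proof.
  intros HA; revert M N; induction HA as [A HA IHA]; intros M N HM.
  revert N; induction HM as [M HM IHM]; intros N HN.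
  induction HN as [N HN IHN]; intros H.
  apply reducible_neutral; [intros ? ? E; discriminate|].
  intros Q HQ; inversion HQ; subst.
  - inversion H0; subst; exact H.
  - inversion H3; subst.
    + inversion H0.
    + apply IHA; auto; constructor; auto.
    + apply IHM; auto; [constructor; auto|].
      apply (reducible_step H), beta_subst; auto.
  (* One step in [N] becomes as many steps of the contractum as the bound variable has occurrences
     in [M]. *)
  - apply IHN; auto; apply (reducible_steps H), beta_steps_subst_pointwise.
    intros [|x]; [apply rt_step; auto | apply rt_refl].
Qed.

Lemma reducible_Lam a b A M :
  SN A -> (forall N, reducible a N -> reducible b (subst0 N M)) ->
  reducible (Arrow a b) (Lam A M).
Proof.
  intros HA H N HN; apply reducible_beta_expand; auto.
  (* Normalization of the open body is read off its instance at a variable, which is reducible at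
     every type. *)
  - apply (SN_preimage (F := subst0 (Var 0))).
    + intros; apply beta_subst; auto.
    + apply (reducible_SN (t := b)), H, reducible_Var.
  - apply (reducible_SN HN).
Qed.

End Reducibility.

(** * Confluence of the encoding *)

Section Confluence.
Variable P : pts_spec.
Local Notation tm := (term (epts_arities P)).
Local Notation step := (beta_rew (epts_theory P)).
Local Notation red := (clos_refl_trans tm step).
Implicit Types (M N A B : tm) (f g : nat -> tm).

(** Parallel reduction in the style of Tait and Martin-Löf. Subterms that a contraction discards
    carry no premise. *)
Inductive par : relation tm :=
| par_Var x : par (Var x) (Var x)
| par_Cst c v w :
    (forall i, par (Vector.nth v i) (Vector.nth w i)) -> par (Cst c v) (Cst c w)
| par_Srt s : par (Srt s) (Srt s)
| par_Pi A A' B B' : par A A' -> par B B' -> par (Pi A B) (Pi A' B')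
| par_Lam A A' M M' : par A A' -> par M M' -> par (Lam A M) (Lam A' M')
| par_App M M' N N' : par M M' -> par N N' -> par (App M N) (App M' N')
| par_beta A M M' N N' :
    par M M' -> par N N' -> par (App (Lam A M) N) (subst0 N' M')
| par_El s1 s2 : pts_ax s1 s2 -> par (dEl s2 (du s1)) (dU s1)
| par_app_abs s1 s2 s3 A B A' B' M M' N N' :
    pts_rule s1 s2 s3 -> par M M' -> par N N' ->
    par (dapp s1 s2 A B (dabs s1 s2 A' B' M) N) (App M' N').

Lemma par_refl M : par M M.
Proof. induction M using term_nested_ind; constructor; auto. Qed.

Lemma step_par M N : step M N -> par M N.
Proof.
  assert (H : forall R, (forall M N, R M N -> par M N) ->
    forall M N, ctx_closure R M N -> par M N).
  { intros R HR M' N' H; induction H; try (constructor; auto using par_refl; fail).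
    - auto.
    - apply par_Cst; intros j; destruct (Fin.eq_dec j i) as [->|Hij].
      + rewrite Vector.nth_replace_eq; auto.
      + rewrite Vector.nth_replace_neq; auto using par_refl. }
  intros [Hs|Hs]; revert Hs; apply H; clear.
  - intros _ _ [A M N]; apply par_beta; apply par_refl.
  - intros _ _ [l r f [s1 s2 Hs|s1 s2 s3 Hs]].
    + exact (par_El Hs).
    + exact (par_app_abs _ _ _ _ Hs (par_refl _) (par_refl _)).
Qed.

Lemma par_red M N : par M N -> red M N.
Proof.
  pose proof (congruence_clos_rt (@compatible_beta_rew _ (epts_theory P))) as Hc.
  intros H; induction H.
  - apply rt_refl.
  - apply (cong_Cst Hc); auto.
  - apply rt_refl.
  - apply (cong_Pi Hc); auto.
  - apply (cong_Lam Hc); auto.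
  - apply (cong_App Hc); auto.
  - eapply rt_trans.
    + apply (cong_App Hc); [apply (cong_Lam Hc); [apply rt_refl|] |]; eassumption.
    + apply rt_step; left; apply cc_head; constructor.
  - apply rt_step; right; apply cc_head.
    exact (rew_intro (T := epts_theory P) Var (rule_El H)).
  - eapply rt_trans; [|apply (cong_App Hc); eassumption].
    apply rt_step; right; apply cc_head.
    (* The list follows the pattern indices of [rule_app], from 0 for [N] up to 5 for [A]. *)
    exact (rew_intro (T := epts_theory P) (inst [N; M; B'; A'; B; A]) (rule_app H)).
Qed.

(** One induction for two uses: renamings first, then arbitrary parallel pairs, whose stability
    under [up] requires the renaming case. *)
Lemma par_subst_generic (ok : relation (nat -> tm)) :
  (forall f g, ok f g -> forall x, par (f x) (g x)) ->
  (forall f g, ok f g -> ok (up f) (up g)) ->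
  forall M N, par M N -> forall f g, ok f g -> par (subst f M) (subst g N).
Proof.
  intros Hpar Hup M N H; induction H; intros f g Hfg; simpl.
  - auto.
  - apply par_Cst; intros i; rewrite !(Vector.nth_map _ _ _ _ eq_refl); auto.
  - constructor.
  - constructor; auto.
  - constructor; auto.
  - constructor; auto.
  - rewrite subst_subst0; constructor; auto.
  - exact (par_El H).
  - exact (par_app_abs _ _ _ _ H (IHpar1 f g Hfg) (IHpar2 f g Hfg)).
Qed.

Lemma par_ren r M N : par M N -> par (ren r M) (ren r N).
Proof.
  intros H; rewrite !ren_subst_Var; revert H.
  refine (fun H => par_subst_generic (ok := fun f g => exists r,
    forall x, f x = Var (r x) /\ g x = Var (r x)) _ _ H _); clear.
  - intros f g [r Hr] x; destruct (Hr x) as [-> ->]; constructor.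
  - intros f g [r Hr]; exists (upren r); intros [|x]; simpl; auto.
    destruct (Hr x) as [-> ->]; auto.
  - exists r; auto.
Qed.

Lemma par_subst f g M N :
  (forall x, par (f x) (g x)) -> par M N -> par (subst f M) (subst g N).
Proof.
  intros Hfg H; apply (par_subst_generic (ok := fun f g => forall x, par (f x) (g x)));
    auto; clear.
  intros f g Hfg [|x]; [constructor | apply par_ren, Hfg].
Qed.

Lemma par_subst0 N N' M M' : par N N' -> par M M' -> par (subst0 N M) (subst0 N' M').
Proof.
  intros HN HM; apply par_subst; auto.
  intros [|x]; [exact HN | apply par_refl].
Qed.

(** The rewrite redexes are described by equations on [M] as a whole, so that no equality between
    dependent vectors arises. *)
Lemma par_inv M N : par M N ->
  match M with
  | Var _ | Srt _ => N = M
  | Pi A B => exists A' B', N = Pi A' B' /\ par A A' /\ par B B'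
  | Lam A Q => exists A' Q', N = Lam A' Q' /\ par A A' /\ par Q Q'
  | App Q R =>
      (exists Q' R', N = App Q' R' /\ par Q Q' /\ par R R') \/
      (exists A Q0 Q' R', Q = Lam A Q0 /\ N = subst0 R' Q' /\ par Q0 Q' /\ par R R')
  | Cst c v =>
      (exists w, N = Cst c w /\ forall i, par (Vector.nth v i) (Vector.nth w i)) \/
      (exists s1 s2, pts_ax s1 s2 /\ M = dEl s2 (du s1) /\ N = dU s1) \/
      (exists s1 s2 s3 A B A' B' Q Q' R R', pts_rule s1 s2 s3 /\
         M = dapp s1 s2 A B (dabs s1 s2 A' B' Q) R /\ N = App Q' R' /\
         par Q Q' /\ par R R')
  end.
Proof.
  intros [ | | | | | | | |]; eauto 10; right; [left|right]; eauto 20.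
Qed.

(** A non-dependent view of the arguments, through which equations between constants can be
    decomposed without decidable equality of sorts. *)
Definition cst_args M : list tm :=
  match M with Cst _ v => Vector.to_list v | _ => [] end.

Lemma par_u_inv s N : par (du s) N -> N = du s.
Proof.
  intros H; apply par_inv in H; simpl in H.
  destruct H as [(w & -> & _)|[(? & ? & _ & E & _)|
    (? & ? & ? & ? & ? & ? & ? & ? & ? & ? & ? & _ & E & _)]];
    [|discriminate E|discriminate E].
  revert w; refine (@Vector.case0 _ _ _); reflexivity.
Qed.

Lemma par_abs_inv s1 s2 A B M N :
  par (dabs s1 s2 A B M) N ->
  exists A' B' M', N = dabs s1 s2 A' B' M' /\ par M M'.
Proof.
  intros H; apply par_inv in H; simpl in H.
  destruct H as [(w & -> & Hw)|[(? & ? & _ & E & _)|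
    (? & ? & ? & ? & ? & ? & ? & ? & ? & ? & ? & _ & E & _)]];
    [|discriminate E|discriminate E].
  revert w Hw; simpl.
  intros w; pattern w; apply Vector.caseS'; clear w; intros A' w.
  pattern w; apply Vector.caseS'; clear w; intros B' w.
  pattern w; apply Vector.caseS'; clear w; intros M' w.
  pattern w; apply Vector.case0; intros Hw.
  exists A', B', M'; split; [reflexivity|].
  exact (Hw (Fin.FS (Fin.FS Fin.F1))).
Qed.

(* For each kind of redex, any two parallel reducts have a common one of the
   form of its contractum, which yields the diamond property. *)
Lemma par_beta_redex A M N X :
  par (App (Lam A M) N) X ->
  exists M1 N1, par M M1 /\ par N N1 /\
    forall M2 N2, par M1 M2 -> par N1 N2 -> par X (subst0 N2 M2).
Proof.
  intros H; apply par_inv in H; simpl in H.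
  destruct H as [(Q & N1 & -> & HQ & HN)|(A' & M' & M1 & N1 & E & -> & HM & HN)].
  - apply par_inv in HQ; destruct HQ as (A1 & M1 & -> & _ & HM).
    exists M1, N1; repeat split; auto; intros; apply par_beta; auto.
  - injection E as <- <-; exists M1, N1; repeat split; auto.
    intros; apply par_subst0; auto.
Qed.

Lemma par_El_redex s1 s2 X :
  pts_ax s1 s2 -> par (dEl s2 (du s1)) X -> par X (dU s1).
Proof.
  intros Hs H; apply par_inv in H; simpl in H.
  destruct H as [(w & -> & Hw)|[(s & s' & _ & E & ->)|
    (? & ? & ? & ? & ? & ? & ? & ? & ? & ? & ? & _ & E & _)]];
    [| |discriminate E].
  - revert w Hw; simpl.
    intros w; pattern w; apply Vector.caseS'; clear w; intros A w.
    pattern w; apply Vector.case0; intros Hw.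
    pose proof (par_u_inv (Hw Fin.F1)) as E; simpl in E; rewrite E.
    apply (par_El Hs).
  - apply (f_equal cst_args) in E; simpl in E; injection E as <-; apply par_refl.
Qed.

Lemma par_app_redex s1 s2 s3 A B A' B' M N X :
  pts_rule s1 s2 s3 ->
  par (dapp s1 s2 A B (dabs s1 s2 A' B' M) N) X ->
  exists M1 N1, par M M1 /\ par N N1 /\
    forall M2 N2, par M1 M2 -> par N1 N2 -> par X (App M2 N2).
Proof.
  intros Hs H; apply par_inv in H; simpl in H.
  destruct H as [(w & -> & Hw)|[(? & ? & _ & E & _)|
    (? & ? & ? & ? & ? & ? & ? & Q & Q' & R & R' & _ & E & -> & HQ & HR)]];
    [|discriminate E|].
  - revert w Hw; simpl.
    intros w; pattern w; apply Vector.caseS'; clear w; intros A1 w.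
    pattern w; apply Vector.caseS'; clear w; intros B1 w.
    pattern w; apply Vector.caseS'; clear w; intros Q w.
    pattern w; apply Vector.caseS'; clear w; intros N1 w.
    pattern w; apply Vector.case0; intros Hw.
    pose proof (Hw (Fin.FS (Fin.FS Fin.F1))) as HQ.
    pose proof (Hw (Fin.FS (Fin.FS (Fin.FS Fin.F1)))) as HN.
    simpl in HQ, HN; destruct (par_abs_inv HQ) as (A2 & B2 & M1 & -> & HM).
    exists M1, N1; repeat split; auto.
    intros M2 N2 HM2 HN2; exact (par_app_abs _ _ _ _ Hs HM2 HN2).
  (* Positions 2 and 3 of an [app] hold the function, here an [abs], and its argument. *)
  - pose proof (f_equal (fun X => nth 3 (cst_args X) X) E) as EN.
    apply (f_equal (fun X => cst_args (nth 2 (cst_args X) X))) in E.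
    simpl in E, EN; injection E as _ _ ->; subst N.
    exists Q', R'; repeat split; auto; intros; apply par_App; auto.
Qed.

Definition diamond_at M : Prop :=
  forall N Q, par M N -> par M Q -> exists R, par N R /\ par Q R.

(* Strengthened because the redexes have depth two. *)
Definition diamond_below M : Prop :=
  diamond_at M /\
  match M with
  | Cst c v => forall i, diamond_at (Vector.nth v i)
  | Lam _ N => diamond_at N
  | _ => True
  end.

Lemma par_diamond_below M : diamond_below M.
Proof.
  induction M as [x|c v IH|s|A B [IHA _] [IHB _]|A M [IHA _] [IHM _]|M N IHM [IHN _]]
    using term_nested_ind.
  - split; [|exact I]; intros N Q HN HQ.
    apply par_inv in HN; apply par_inv in HQ; subst; eauto using par_refl.
  - split; [|intros i; apply IH]; intros N Q HN HQ.
    (* The induction hypothesis is phrased as a predicate of the whole term, so that rewriting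
       [Cst c v] into a redex transports it to the redex's components. *)
    pose (args_ok X := match X with
                       | Cst c v => forall i, diamond_below (Vector.nth v i)
                       | _ => True end).
    assert (Hok : args_ok (Cst c v)) by exact IH.
    pose proof (par_inv HN) as HN'; pose proof (par_inv HQ) as HQ'; simpl in HN', HQ'.
    assert (HE : forall s1 s2, pts_ax s1 s2 -> Cst c v = dEl s2 (du s1) ->
      exists R, par N R /\ par Q R).
    { intros s1 s2 Hs E; rewrite E in HN, HQ.
      exists (dU s1); split; apply (par_El_redex Hs); auto. }
    assert (HA : forall s1 s2 s3 A B A' B' M M', pts_rule s1 s2 s3 ->
      Cst c v = dapp s1 s2 A B (dabs s1 s2 A' B' M) M' ->
      exists R, par N R /\ par Q R).
    { intros s1 s2 s3 A B A' B' M M' Hs E; rewrite E in HN, HQ, Hok.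
      (* Position 2 of the [app] is the [abs], and position 2 of the latter is its body: the second
         component of [diamond_below] reaches this depth. *)
      destruct (Hok (Fin.FS (Fin.FS Fin.F1))) as [_ Habs].
      specialize (Habs (Fin.FS (Fin.FS Fin.F1))); simpl in Habs.
      destruct (Hok (Fin.FS (Fin.FS (Fin.FS Fin.F1)))) as [HM' _]; simpl in HM'.
      destruct (par_app_redex Hs HN) as (M1 & M1' & HM1 & HM1' & HN1).
      destruct (par_app_redex Hs HQ) as (M2 & M2' & HM2 & HM2' & HN2).
      destruct (Habs _ _ HM1 HM2) as (M3 & HM13 & HM23).
      destruct (HM' _ _ HM1' HM2') as (M3' & HM13' & HM23').
      exists (App M3 M3'); auto. }
    destruct HN' as [(w & -> & Hw)|[(? & ? & Hs & E & _)|
      (? & ? & ? & ? & ? & ? & ? & ? & ? & ? & ? & Hs & E & _)]];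
      [|eapply HE; eauto|eapply HA; eauto].
    destruct HQ' as [(w' & -> & Hw')|[(? & ? & Hs & E & _)|
      (? & ? & ? & ? & ? & ? & ? & ? & ? & ? & ? & Hs & E & _)]];
      [|eapply HE; eauto|eapply HA; eauto].
    destruct (vector_choice (R := fun i a =>
      par (Vector.nth w i) a /\ par (Vector.nth w' i) a)) as [u Hu].
    { intros i; apply (proj1 (IH i)); auto. }
    exists (Cst c u); split; apply par_Cst; intros i; apply Hu.
  - split; [|exact I]; intros N Q HN HQ.
    apply par_inv in HN; apply par_inv in HQ; subst; eauto using par_refl.
  - split; [|exact I]; intros N Q HN HQ.
    apply par_inv in HN; destruct HN as (A1 & B1 & -> & HA1 & HB1).
    apply par_inv in HQ; destruct HQ as (A2 & B2 & -> & HA2 & HB2).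
    destruct (IHA _ _ HA1 HA2) as (A3 & ? & ?).
    destruct (IHB _ _ HB1 HB2) as (B3 & ? & ?).
    exists (Pi A3 B3); split; constructor; auto.
  - split; [|exact IHM]; intros N Q HN HQ.
    apply par_inv in HN; destruct HN as (A1 & B1 & -> & HA1 & HB1).
    apply par_inv in HQ; destruct HQ as (A2 & B2 & -> & HA2 & HB2).
    destruct (IHA _ _ HA1 HA2) as (A3 & ? & ?).
    destruct (IHM _ _ HB1 HB2) as (B3 & ? & ?).
    exists (Lam A3 B3); split; constructor; auto.
  - split; [|exact I]; intros X Y HX HY.
    assert (HB : forall A M', M = Lam A M' -> exists R, par X R /\ par Y R).
    { intros A M' ->; destruct IHM as [_ IHM'].
      destruct (par_beta_redex HX) as (M1 & N1 & HM1 & HN1 & HX1).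
      destruct (par_beta_redex HY) as (M2 & N2 & HM2 & HN2 & HY2).
      destruct (IHM' _ _ HM1 HM2) as (M3 & ? & ?).
      destruct (IHN _ _ HN1 HN2) as (N3 & ? & ?).
      exists (subst0 N3 M3); auto. }
    apply par_inv in HX; apply par_inv in HY; simpl in HX, HY.
    destruct HX as [(M1 & N1 & -> & HM1 & HN1)|(? & ? & ? & ? & -> & _)];
      [|eapply HB; reflexivity].
    destruct HY as [(M2 & N2 & -> & HM2 & HN2)|(? & ? & ? & ? & -> & _)];
      [|eapply HB; reflexivity].
    destruct (proj1 IHM _ _ HM1 HM2) as (M3 & ? & ?).
    destruct (IHN _ _ HN1 HN2) as (N3 & ? & ?).
    exists (App M3 N3); split; constructor; auto.
Qed.

Theorem epts_confluent : confluent step.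
Proof.
  apply (diamond_confluent (S := par)).
  - apply step_par.
  - apply par_red.
  - intros M; apply par_diamond_below.
Qed.

(** Consequently a product is never a redex, and its reductions take place in its components. *)
Lemma rew_head_Cst M N : rew_head (epts_theory P) M N -> exists c v, M = Cst c v.
Proof. intros [l r f [|]]; do 2 eexists; reflexivity. Qed.

Lemma red_Pi_inv A B X :
  red (Pi A B) X -> exists A' B', X = Pi A' B' /\ red A A' /\ red B B'.
Proof.
  intros H; apply clos_rt_rtn1 in H; induction H as [|X Y HXY _ (A' & B' & -> & HA & HB)].
  - exists A, B; repeat split; apply rt_refl.
  - destruct HXY as [H|H]; inversion H; subst.
    + inversion H0.
    + exists A'0, B'; repeat split; auto; eapply rt_trans; [eassumption|].
      apply rt_step; left; auto.
    + exists A', B'0; repeat split; auto; eapply rt_trans; [eassumption|].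
      apply rt_step; left; auto.
    + destruct (rew_head_Cst H0) as (? & ? & E); discriminate E.
    + exists A'0, B'; repeat split; auto; eapply rt_trans; [eassumption|].
      apply rt_step; right; auto.
    + exists A', B'0; repeat split; auto; eapply rt_trans; [eassumption|].
      apply rt_step; right; auto.
Qed.

Lemma conv_Pi_injective A B A' B' :
  conv (epts_theory P) (Pi A B) (Pi A' B') ->
  conv (epts_theory P) A A' /\ conv (epts_theory P) B B'.
Proof.
  intros H; destruct (confluent_church_rosser epts_confluent H) as (X & HX & HX').
  destruct (red_Pi_inv HX) as (A1 & B1 & -> & HA & HB).
  destruct (red_Pi_inv HX') as (A2 & B2 & E & HA' & HB'); injection E as <- <-.
  split; eapply rst_trans; try (apply clos_rt_clos_rst; eassumption);
    apply rst_sym, clos_rt_clos_rst; assumption.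
Qed.

End Confluence.

(** * Strong normalization of beta *)

(* Only meaningful on types and kinds, where it forgets dependencies. *)
Fixpoint erase (K : arities) (M : term K) : simple_type :=
  match M with
  | Pi A B => Arrow (erase A) (erase B)
  | Lam _ N => erase N
  | App N _ => erase N
  | _ => Base
  end.

Lemma erase_ren K (M : term K) : forall r, erase (ren r M) = erase M.
Proof. induction M; intros r; simpl; auto; f_equal; auto. Qed.

Section StrongNormalization.
Variable P : pts_spec.
Local Notation tm := (term (epts_arities P)).
Local Notation T := (epts_theory P).
Local Notation red := (clos_refl_trans tm (beta_rew T)).
Implicit Types (M N A B : tm) (f : nat -> tm).

(* Contexts contain no type variables, so that no variable and no object
   constant ever comes to the head of a type family: the three classes below are
   stable under untyped substitution and reduction. *)
Fixpoint family M : Prop :=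
  match M with
  | Cst (cU _) _ | Cst (cEl _) _ => True
  | Pi A B => family A /\ family B
  | Lam _ N => family N
  | App N _ => family N
  | _ => False
  end.

Fixpoint kind M : Prop :=
  match M with
  | Srt TYPE => True
  | Pi A B => family A /\ kind B
  | _ => False
  end.

Inductive class : Set := Family | Kind | Top.

Definition in_class (k : class) M : Prop :=
  match k with
  | Family => family M
  | Kind => kind M
  | Top => M = Srt KIND
  end.

Lemma in_class_unique k k' M : in_class k M -> in_class k' M -> k = k'.
Proof.
  assert (H : forall M, family M -> kind M -> False).
  { intros N; induction N as [| |[|]| | |]; simpl; tauto. }
  destruct k, k'; simpl; intros H1 H2; auto; exfalso; subst; eauto.
Qed.

(** The leaves that [erase] visits in a family are constants [cU] or [cEl], which a substitution
    leaves in place. *)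
Lemma family_subst M : forall f, family M ->
  family (subst f M) /\ erase (subst f M) = erase M.
Proof.
  induction M as [x|[]|s|A IHA B IHB|A _ M IHM|M IHM N _]; simpl; intros f H; try tauto; auto.
  destruct H as [HA HB]; destruct (IHA f HA), (IHB (up f) HB); split; auto.
  f_equal; auto.
Qed.

Lemma kind_subst M : forall f, kind M ->
  kind (subst f M) /\ erase (subst f M) = erase M.
Proof.
  induction M as [x|c v|s|A IHA B IHB|A _ M IHM|M IHM N _]; simpl; intros f H; try tauto; auto.
  destruct H as [HA HB]; destruct (family_subst f HA), (IHB (up f) HB); split; auto.
  f_equal; auto.
Qed.

(** Head steps never start from a kind or from [KIND]. On families, beta keeps the erasure of the
    body, [El u] becomes [U] with both at the base type, and the [app] rule does not apply. *)
Lemma in_class_step k M N :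
  beta_rew T M N -> in_class k M -> in_class k N /\ erase N = erase M.
Proof.
  enough (H : forall R,
    (forall M N, R M N -> (family M -> family N /\ erase N = erase M) /\
                          ~ kind M /\ M <> Srt KIND) ->
    forall M N, ctx_closure R M N ->
    (family M -> family N /\ erase N = erase M) /\
    (kind M -> kind N /\ erase N = erase M) /\ M <> Srt KIND).
  { intros HMN HM.
    assert (HM' : (family M -> family N /\ erase N = erase M) /\
      (kind M -> kind N /\ erase N = erase M) /\ M <> Srt KIND).
    { destruct HMN as [HMN|HMN]; revert HMN; apply H; clear.
      - intros _ _ [A M N]; repeat split; simpl; try tauto; try discriminate.
        + apply family_subst; auto.
        + apply family_subst; auto.
      - intros _ _ [l r f [|]]; repeat split; simpl; auto; try tauto;
          try discriminate; exfalso; assumption. }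
    destruct HM' as (HF & HK & HT), k; simpl in *; tauto. }
  clear; intros R HR M N H.
  induction H as [M N H|c v i N _ _|A A' B _ (IHF & IHK & _)|A B B' _ (IHF & IHK & _)
    |A A' M _ _|A M M' _ (IHF & IHK & _)|M M' N _ (IHF & IHK & _)|M N N' _ _];
    simpl; (split; [|split]); try discriminate; try tauto.
  - apply (HR _ _ H).
  - intros HM; exfalso; apply (proj1 (proj2 (HR _ _ H)) HM).
  - apply (HR _ _ H).
  - intros [HA HB]; destruct (IHF HA) as [? ->]; auto.
  - intros [HA HB]; destruct (IHF HA) as [? ->]; auto.
  - intros [HA HB]; destruct (IHF HB) as [? ->]; auto.
  - intros [HA HB]; destruct (IHK HB) as [? ->]; auto.
Qed.

Lemma in_class_red k M N :
  red M N -> in_class k M -> in_class k N /\ erase N = erase M.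
Proof.
  intros H; induction H as [M N H|M|M N Q _ IH1 _ IH2]; intros HM.
  - apply (in_class_step H HM).
  - auto.
  - destruct (IH1 HM) as [HN E]; destruct (IH2 HN) as [HQ E']; split; congruence.
Qed.

(** The classes are not closed under expansion, so a conversion cannot be followed step by step;
    through a common reduct, both ends only reduce. *)
Lemma in_class_conv k k' A B :
  conv T A B -> in_class k A -> in_class k' B -> k = k' /\ erase A = erase B.
Proof.
  intros H HA HB; destruct (confluent_church_rosser (@epts_confluent P) H) as (C & HAC & HBC).
  destruct (in_class_red HAC HA) as [HC <-]; destruct (in_class_red HBC HB) as [HC' <-].
  split; auto; eapply in_class_unique; eauto.
Qed.

(** The cases are kinds, type families and objects; an object is constrained only through its
    type. *)
Definition stratified M A : Prop :=
  in_class Kind M /\ A = Srt KIND \/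
  in_class Family M /\ in_class Kind A \/
  in_class Family A.

Lemma stratified_Srt M s :
  stratified M (Srt s) -> in_class (match s with TYPE => Family | KIND => Kind end) M.
Proof.
  intros [[HM E]|[[HM HA]|HA]]; simpl in *; [injection E as ->| |contradiction]; auto.
  destruct s; [auto | contradiction].
Qed.

(** The clause on contexts, valid because declarations have type [TYPE], settles variables. In a
    conversion the class cannot change, by [in_class_conv]. *)
Lemma typing_stratified :
  (forall G M A, typing T G M A -> stratified M A) /\
  (forall G, wf T G -> forall x A, nth_error G x = Some A -> in_class Family A) /\
  (forall G Ms D, typing_args T G Ms D -> True).
Proof.
  apply typing_wf_args_ind; auto.
  - intros; left; simpl; auto.
  - intros G x A _ IH Hx; right; right; simpl.
    rewrite ren_subst_Var; apply family_subst, (IH _ _ Hx).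
  - intros G c v D A Hd _ _; unfold stratified; destruct Hd; simpl; auto.
  - intros G A B s _ IHA _ IHB; apply stratified_Srt in IHA, IHB.
    destruct s; [right; left | left]; simpl in *; auto.
  - intros G A B M s _ IHA _ IHB _ IHM; apply stratified_Srt in IHA, IHB.
    destruct IHM as [[HM ->]|[[HM HB]|HB]]; unfold stratified; simpl in *; auto.
    destruct s; contradiction.
  - intros G A B M N _ IHM _ _.
    destruct IHM as [[_ E]|[[HM HB]|HB]]; [discriminate| |]; simpl in HB.
    + right; left; split; [exact HM | apply kind_subst, HB].
    + right; right; apply family_subst, HB.
  - intros G M A B s _ IHM _ IHB HAB; apply stratified_Srt in IHB.
    set (k := match s with TYPE => Family | KIND => Kind end) in IHB.
    destruct IHM as [[HM ->]|[[HM HA]|HA]].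
    + destruct (in_class_conv (k := Top) HAB eq_refl IHB) as [E _].
      unfold k in E; destruct s; discriminate.
    + destruct (in_class_conv HAB HA IHB) as [<- _]; right; left; auto.
    + destruct (in_class_conv HAB HA IHB) as [<- _]; right; right; auto.
  - intros [|x] A H; discriminate H.
  - intros G A _ IHG _ IHA [|x] C Hx; simpl in Hx; [|eapply IHG, Hx].
    injection Hx as <-; apply (stratified_Srt IHA).
Qed.

Lemma typing_type_in_class G M A : typing T G M A -> exists k, in_class k A.
Proof.
  intros H; apply typing_stratified in H.
  destruct H as [[_ ->]|[[_ H]|H]]; [exists Top; reflexivity| |]; eauto.
Qed.

Lemma erase_subst k A f : in_class k A -> erase (subst f A) = erase A.
Proof.
  destruct k; simpl; intros H; [apply family_subst, H | apply kind_subst, H |].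
  subst; reflexivity.
Qed.

Definition reducible_for (G : ctx (epts_arities P)) f : Prop :=
  forall x A, nth_error G x = Some A -> reducible (erase A) (f x).

Lemma reducible_for_scons G A f N :
  reducible_for G f -> reducible (erase A) N -> reducible_for (A :: G) (scons N f).
Proof.
  intros Hf HN [|x] B Hx; simpl in *; [injection Hx as <-; exact HN | apply Hf, Hx].
Qed.

Lemma typing_reducible :
  (forall G M A, typing T G M A -> forall f, reducible_for G f ->
     reducible (erase A) (subst f M)) /\
  (forall G, wf T G -> True) /\
  (forall G Ms D, typing_args T G Ms D -> forall f, reducible_for G f ->
     forall M, In M Ms -> strongly_normalizing (@beta _) (subst f M)).
Proof.
  apply typing_wf_args_ind; auto.
  - intros G _ _ f _; constructor; intros N H; inversion H; inversion H0.
  - intros G x A _ _ Hx f Hf; rewrite erase_ren; apply Hf, Hx.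
  - intros G c v D A Hd _ IH f Hf.
    (* A declared type is [TYPE] or headed by [cU] or [cEl]; at the base type, reducibility is
       strong normalization, and the arguments need no more than that. *)
    replace (erase _) with Base by (destruct Hd; reflexivity).
    apply SN_Cst; intros i; rewrite (Vector.nth_map _ _ _ _ eq_refl).
    apply (IH f Hf), in_rev; rewrite rev_involutive.
    apply Vector.to_list_In, Vector.In_nth.
  - intros G A B s _ IHA _ IHB f Hf; apply SN_Pi; [apply (IHA f Hf)|].
    apply (SN_preimage (F := subst0 (Var 0))); [intros; apply beta_subst; auto|].
    rewrite subst0_up; apply IHB, reducible_for_scons; auto using reducible_Var.
  - intros G A B M s _ IHA _ _ _ IHM f Hf; apply reducible_Lam; [apply (IHA f Hf)|].
    intros N HN; rewrite subst0_up; apply IHM, reducible_for_scons; auto.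
  - intros G A B M N HM IHM _ IHN f Hf.
    replace (erase (subst0 N B)) with (erase B).
    + apply (IHM f Hf), IHN, Hf.
    (* The product typing the function lies in a class, so its codomain is a family or a kind and
       its erasure ignores the substituted argument. *)
    + destruct (typing_type_in_class HM) as [k Hk]; symmetry.
      destruct k; [| |discriminate]; simpl in Hk;
        [apply (erase_subst (k := Family)) | apply (erase_subst (k := Kind))]; apply Hk.
  - intros G M A B s HM IHM HB _ HAB f Hf.
    destruct (typing_type_in_class HM) as [k HA].
    pose proof (stratified_Srt (proj1 typing_stratified _ _ _ HB)) as HB'.
    destruct (in_class_conv HAB HA HB') as [_ <-]; auto.
  - intros G _ _ f _ M [].
  - intros G Ms D M A _ IHMs _ IHM f Hf N [<-|HN]; [|apply IHMs; auto].
    apply (reducible_SN (IHM f Hf)).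
Qed.

Theorem typing_beta_SN G M A :
  typing T G M A -> strongly_normalizing (@beta (epts_arities P)) M.
Proof.
  intros H; rewrite <- (subst_Var M); apply (reducible_SN (t := erase A)).
  apply (proj1 typing_reducible _ _ _ H); intros x B _; apply reducible_Var.
Qed.

End StrongNormalization.

(** * Typing of the signature and compositionality of the translation *)

Section Encoding.
Variable P : pts_spec.
Local Notation tm := (term (epts_arities P)).
Local Notation T := (epts_theory P).
Implicit Types (s : sort P) (A B : tm) (G : ctx (epts_arities P)).

(** On concrete argument vectors, [rev] and [inst] in [t_cst] compute away, so the derived rules
    hold by definitional equality. *)
Lemma typing_U G s : wf T G -> typing T G (dU s) (Srt TYPE).
Proof.
  intros HG; exact (t_cst (T := T) (c := cU s) (v := Vector.nil tm) (decl_U s) (ta_nil HG)).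
Qed.

Lemma typing_El G s A : typing T G A (dU s) -> typing T G (dEl s A) (Srt TYPE).
Proof.
  intros HA; pose proof (typing_wf HA) as HG.
  refine (t_cst (T := T) (c := cEl s) (v := Vector.cons tm A 0 (Vector.nil tm)) (decl_El s) _).
  exact (ta_cons (A := dU s) (ta_nil HG) HA).
Qed.

Lemma typing_Prod G s1 s2 s3 A B :
  pts_rule s1 s2 s3 -> typing T G A (dU s1) ->
  typing T G B (Pi (dEl s1 A) (dU s2)) -> typing T G (dProd s1 s2 A B) (dU s3).
Proof.
  intros Hs HA HB; pose proof (typing_wf HA) as HG.
  refine (t_cst (T := T) (c := cProd s1 s2)
    (v := Vector.cons tm A _ (Vector.cons tm B 0 (Vector.nil tm))) (decl_Prod Hs) _).
  exact (ta_cons (A := Pi (dEl s1 (Var 0)) (dU s2))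
    (ta_cons (A := dU s1) (ta_nil HG) HA) HB).
Qed.

Lemma wf_ctx_AB s1 s2 : wf T (ctx_AB s1 s2).
Proof.
  assert (H1 : wf T [dU s1]) by (constructor; [|apply typing_U]; constructor).
  assert (H2 : typing T [dU s1] (dEl s1 (Var 0)) (Srt TYPE)).
  { apply typing_El; exact (t_var (x := 0) H1 eq_refl). }
  constructor; auto; constructor; auto.
  apply typing_U; constructor; auto.
Qed.

Theorem epts_decl_typed c D A :
  decl T c D A -> exists s : srt, typing T D A (Srt s).
Proof.
  intros [s|s|s1 s2 _|s1 s2 s3 _|s1 s2 s3 Hs|s1 s2 s3 Hs].
  - exists KIND; repeat constructor.
  - exists KIND; constructor; constructor; [|apply typing_U]; constructor.
  - exists TYPE; apply typing_U; constructor.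
  - exists TYPE; apply typing_U, wf_ctx_AB.
  - exists TYPE; pose proof (wf_ctx_AB s1 s2) as H.
    set (C := Pi _ _).
    assert (HA : typing T (ctx_AB s1 s2) (dEl s1 (Var 1)) (Srt TYPE)).
    { apply typing_El; exact (t_var (x := 1) H eq_refl). }
    assert (HC : wf T (C :: ctx_AB s1 s2)).
    { constructor; auto; constructor; auto; apply typing_El.
      assert (H' : wf T (dEl s1 (Var 1) :: ctx_AB s1 s2)) by (constructor; auto).
      exact (t_app (t_var (x := 1) H' eq_refl) (t_var (x := 0) H' eq_refl)). }
    apply typing_El, typing_Prod; auto.
    + exact (t_var (x := 2) HC eq_refl).
    + exact (t_var (x := 1) HC eq_refl).
  - exists TYPE; pose proof (wf_ctx_AB s1 s2) as H.
    set (C := dEl s3 _).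
    assert (HC : wf T (C :: ctx_AB s1 s2)).
    { constructor; auto; apply typing_El, typing_Prod; auto.
      - exact (t_var (x := 1) H eq_refl).
      - exact (t_var (x := 0) H eq_refl). }
    assert (H' : wf T (dEl s1 (Var 2) :: C :: ctx_AB s1 s2)).
    { constructor; auto; apply typing_El; exact (t_var (x := 2) HC eq_refl). }
    apply typing_El.
    exact (t_app (t_var (x := 2) H' eq_refl) (t_var (x := 0) H' eq_refl)).
Qed.

(** * Compositionality of the translation *)

Lemma tr_eren (M : eterm P) : forall r, tr (eren r M) = ren r (tr M).
Proof.
  induction M; intros r; simpl; unfold dProd, dabs, dapp, dEl;
    repeat (f_equal; auto).
Qed.

(** Pointwise related parallel substitutions pass under binders and cover both the substitution for
    a free variable and that for the innermost bound one. *)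
Lemma tr_esubst (M : eterm P) : forall f g, (forall x, tr (f x) = g x) ->
  tr (esubst f M) = subst g (tr M).
Proof.
  assert (Hup : forall (f : nat -> eterm P) g, (forall x, tr (f x) = g x) ->
    forall x, tr (eup f x) = up g x).
  { intros f g H [|x]; simpl; [|rewrite tr_eren, H]; reflexivity. }
  induction M; intros f g E; simpl; unfold dProd, dabs, dapp, dEl; auto;
    repeat (f_equal; auto).
Qed.

End Encoding.

Theorem mainTheorem9 (P : pts_spec) (HP : functional_spec P) :
  confluent (beta_rew (epts_theory P)) /\
  (forall c D A, decl (epts_theory P) c D A ->
     exists s : srt, typing (epts_theory P) D A (Srt s)) /\
  (forall G M M' A, typing (epts_theory P) G M A -> beta M M' ->
     typing (epts_theory P) G M' A) /\
  (forall G M A, typing (epts_theory P) G M A ->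
     strongly_normalizing (@beta (epts_arities P)) M) /\
  (forall M N : eterm P,
     (forall x : nat, subst_var x (tr N) (tr M) = tr (esubst_var x N M)) /\
     subst0 (tr N) (tr M) = tr (esubst0 N M)).
Proof.
  split; [|split; [|split; [|split]]].
  - apply epts_confluent.
  - apply epts_decl_typed.
  - apply (subject_reduction_beta (@epts_decl_typed P) (@conv_Pi_injective P)).
  - apply typing_beta_SN.
  - intros M N; split; [intros x|rewrite subst0_scons]; symmetry; apply tr_esubst.
    + intros y; destruct (Nat.eqb y x); reflexivity.
    + intros [|y]; reflexivity.
Qed.
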